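(* Let $\mathbb{F}$ be a field with $\operatorname{char}\mathbb{F}\neq 2,3$, and let $s$ be a Steinitz number. Let $H$ be the cyclic group of order $2$ generated by the automorphism $\psi:g\mapsto(g^{-1})^t$, $g\in SL_s^p(\mathbb{F})$, of the group $SL_s^p(\mathbb{F})$, where $t$ is the matrix transpose. Then $$\operatorname{Aut}\big(SL_s^p(\mathbb{F})\big)=H\cdot\operatorname{Aut}_{\mathbb{F}}\big(M_s^p(\mathbb{F})\big)\cdot\operatorname{Aut}(\mathbb{F}).$$
   Context: A Steinitz number is a formal product $\prod_{p}p^{r_p}$ over all primes $p$ with $r_p\in\mathbb{N}\cup\{0,\infty\}$; Steinitz numbers are multiplied by adding exponents (with $\infty$ absorbing), and $s_2\mid s_1$ if $s_1=s_2s_3$ for some Steinitz number $s_3$. An $(\mathbb{N}\times\mathbb{N})$-matrix over $\mathbb{F}$ is $n$-periodic if it is block-diagonal of the form $\operatorname{diag}(a,a,\ldots)$ with $a\in M_n(\mathbb{F})$, the algebra of $(n\times n)$-matrices over $\mathbb{F}$. $M_n^p(\mathbb{F})\cong M_n(\mathbb{F})$ is the algebra of all $n$-periodic matrices, and $GL_n^p(\mathbb{F})$ is its group of invertible elements. For a Steinitz number $s$, $M_s^p(\mathbb{F})=\bigcup_{n\mid s}M_n^p(\mathbb{F})$ and $GL_s^p(\mathbb{F})=\bigcup_{n\mid s}GL_n^p(\mathbb{F})$ (unions over positive integers $n$ dividing $s$), and $SL_s^p(\mathbb{F})=[GL_s^p(\mathbb{F}),GL_s^p(\mathbb{F})]$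 is the commutator subgroup. The algebra $M_s^p(\mathbb{F})$ is invariant under the transpose $t$. $\operatorname{Aut}(SL_s^p(\mathbb{F}))$ is the group of abstract group automorphisms; $\operatorname{Aut}_{\mathbb{F}}(M_s^p(\mathbb{F}))$ is the group of $\mathbb{F}$-algebra automorphisms; $\operatorname{Aut}(\mathbb{F})$ is the group of field automorphisms. An automorphism $\tau$ of $\mathbb{F}$ acts on $M_s^p(\mathbb{F})$ by the ring automorphism $\widetilde{\tau}:(a_{ij})\mapsto(\tau(a_{ij}))$. Every ring automorphism of $M_s^p(\mathbb{F})$ preserves $SL_s^p(\mathbb{F})$; in the formula, $\operatorname{Aut}_{\mathbb{F}}(M_s^p(\mathbb{F}))$ and $\operatorname{Aut}(\mathbb{F})$ stand for the subgroups of $\operatorname{Aut}(SL_s^p(\mathbb{F}))$ obtained by restricting to $SL_s^p(\mathbb{F})$ the $\mathbb{F}$-algebra automorphisms and the automorphisms $\widetilde{\tau}$, respectively. The right-hand side is the set of all products of an element of each of the three subgroups, in the indicated order. *)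

(* Defs.v *)
From HB Require Import structures.
From mathcomp Require Import all_boot all_order all_algebra.
From mathcomp Require Import all_classical.

Set Implicit Arguments.
Unset Strict Implicit.
Unset Printing Implicit Defensive.

Import GRing.Theory.

Local Open Scope ring_scope.
Local Open Scope classical_set_scope.

Definition prime_number := {p : nat | prime p}.

(* [None] is the exponent infinity. *)
Definition steinitz := prime_number -> option nat.

Definition steinitz_mul (s1 s2 : steinitz) : steinitz := fun p =>
  if (s1 p, s2 p) is (Some a, Some b) then Some (a + b)%N else None.

Definition steinitz_dvd (s2 s1 : steinitz) : Prop :=
  exists s3, s1 = steinitz_mul s2 s3.

(* Meaningful for [0 < n] only: [logn p 0 = 0]. *)
Definition steinitz_of_nat (n : nat) : steinitz := fun p =>
  Some (logn (val p) n).

Definition pos_divisors (s : steinitz) : set nat :=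
  [set n | (0 < n)%N /\ steinitz_dvd (steinitz_of_nat n) s].

Lemma steinitz_dvd_natP n s :
  steinitz_dvd (steinitz_of_nat n) s <->
  forall p, if s p is Some e then (logn (val p) n <= e)%N else true.
Proof.
split=> [[s3 ->] p|H].
  by rewrite /steinitz_mul /=; case: (s3 p) => //= e; rewrite leq_addr.
exists (fun p => if s p is Some e then Some (e - logn (val p) n)%N else None).
apply/funext => p; move: (H p); rewrite /steinitz_mul /=.
by case: (s p) => // e le_e; rewrite subnKC.
Qed.

Lemma pos_divisors1 s : pos_divisors s 1%N.
Proof. by split=> //; apply/steinitz_dvd_natP => p; rewrite logn1; case: (s p). Qed.

Lemma pos_divisors_lcm s m n :
  pos_divisors s m -> pos_divisors s n -> pos_divisors s (lcmn m n).
Proof.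
move=> [m0 /steinitz_dvd_natP ms] [n0 /steinitz_dvd_natP ns].
split; first by rewrite lcmn_gt0 m0.
apply/steinitz_dvd_natP => p; move: (ms p) (ns p); case: (s p) => // e me ne.
by rewrite logn_lcm // geq_max me.
Qed.

Definition nmatrix (F : fieldType) := nat -> nat -> F.

Section NMatrix.
Variable F : fieldType.
Implicit Types (A B C : nmatrix F) (n m : nat).

Definition nmx1 : nmatrix F := fun i j => (i == j)%:R.

(* The sum is over all [k : nat]; by convention it is 0 when infinitely many
   terms are nonzero, which does not happen for periodic matrices. *)
Definition nmx_mul A B : nmatrix F := fun i j =>
  \sum_(k \in [set: nat]) (A i k * B k j).

Definition nmx_tr A : nmatrix F := fun i j => A j i.

Definition nmx_map (tau : F -> F) A : nmatrix F := fun i j => tau (A i j).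

(* diag(a, a, ...): the (k, l)-th (n x n)-block is [a] if [k = l] and 0
   otherwise.  Meaningful for [0 < n] only. *)
Definition Mnp n : set (nmatrix F) := [set A | exists a : 'M[F]_n,
  forall (k l : nat) (i j : 'I_n),
    A (k * n + i)%N (l * n + j)%N = if k == l then a i j else 0].

Definition GLnp n : set (nmatrix F) := [set A | Mnp n A /\
  exists B, [/\ Mnp n B, nmx_mul A B = nmx1 & nmx_mul B A = nmx1]].

Definition Msp (s : steinitz) : set (nmatrix F) :=
  \bigcup_(n in pos_divisors s) Mnp n.

Definition GLsp (s : steinitz) : set (nmatrix F) :=
  \bigcup_(n in pos_divisors s) GLnp n.

Definition nmx_diag n (a : 'M[F]_n.+1) : nmatrix F := fun i j =>
  if (i %/ n.+1 == j %/ n.+1)%N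
  then a (inord (i %% n.+1)) (inord (j %% n.+1)) else 0.

Lemma Mnp_diag n (a : 'M[F]_n.+1) : Mnp n.+1 (nmx_diag a).
Proof.
exists a => k l i j; rewrite /nmx_diag !divnMDl // !modnMDl.
rewrite !(@divn_small _ n.+1) // !addn0 !modn_small //.
by rewrite !inord_val.
Qed.

Lemma MnpP n A : Mnp n.+1 A <-> exists a : 'M[F]_n.+1, A = nmx_diag a.
Proof.
split=> [[a Aa]|[a ->]]; last exact: Mnp_diag.
exists a; apply/funext => i; apply/funext => j; rewrite /nmx_diag.
have := Aa (i %/ n.+1)%N (j %/ n.+1)%N (inord (i %% n.+1)) (inord (j %% n.+1)).
by rewrite !inordK ?ltn_pmod // -!divn_eq.
Qed.

Lemma Mnp_dvd n m A : (0 < m)%N -> (n %| m)%N -> Mnp n A -> Mnp m A.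
Proof.
move=> m0 /dvdnP[q def_m]; case: n => [|n] in def_m *.
  by rewrite def_m muln0 in m0.
move=> /MnpP[a ->]; exists (\matrix_(i, j) nmx_diag a i j) => k l i j.
have n_m (x y : nat) : (x * m + y = x * q * n.+1 + y)%N.
  by rewrite def_m mulnA.
have ltq (x : 'I_m) : (x %/ n.+1 < q)%N by rewrite ltn_divLR // -def_m.
rewrite mxE /nmx_diag !n_m !modnMDl !divnMDl //.
case: (eqVneq k l) => [->|kl]; first by rewrite eqn_add2l.
case: eqP => // E; case/eqP: kl.
have := congr1 (fun x => x %/ q)%N E.
have q0 : (0 < q)%N by apply: leq_ltn_trans (ltq i).
by rewrite /= !divnMDl // !(@divn_small _ q) ?ltq // !addn0.
Qed.

Lemma nmx_diag1 n : nmx_diag (1%:M : 'M_n.+1) = nmx1.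
Proof.
apply/funext => i; apply/funext => j; rewrite /nmx_diag /nmx1 mxE -val_eqE /=.
rewrite !inordK ?ltn_pmod // {3}(divn_eq i n.+1) {3}(divn_eq j n.+1).
case: eqP => [->|ne]; first by rewrite eqn_add2l.
case: eqP => // E; case: ne; have := congr1 (fun x => x %/ n.+1)%N E.
by rewrite /= !divnMDl // !(divn_small (ltn_pmod _ _)) // !addn0.
Qed.

Lemma nmx_diagM n (a b : 'M[F]_n.+1) :
  nmx_mul (nmx_diag a) (nmx_diag b) = nmx_diag (a *m b).
Proof.
apply/funext => i; apply/funext => j; rewrite /nmx_mul.
set q := (i %/ n.+1)%N; pose h k := (q * n.+1 + k)%N.
rewrite -(fsbig_widen (h @` `I_n.+1) setT) //=; last first.
  move=> k [_ /= nk]; rewrite /nmx_diag -/q; case: eqP => [qk|_]; last first.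
    by rewrite mul0r.
  case: nk; exists (k %% n.+1)%N; first by rewrite /= ltn_pmod.
  by rewrite /h qk -divn_eq.
rewrite fsbig_image; last by move=> x y _ _ /addnI.
rewrite -(@fsbig_ord _ _ +%R n.+1 (fun k => nmx_diag a i (h k) * nmx_diag b (h k) j)).
rewrite /nmx_diag -/q /h; case: eqP => [qj|nqj].
  rewrite mxE; apply: eq_bigr => k _; rewrite divnMDl // modnMDl.
  rewrite (divn_small (ltn_ord k)) addn0 eqxx qj eqxx (modn_small (ltn_ord k)).
  by rewrite inord_val.
apply: big1 => k _; rewrite divnMDl // (divn_small (ltn_ord k)) addn0 eqxx.
by case: eqP => [/nqj|_]; rewrite ?mulr0.
Qed.

Lemma Mnp_add n A B : Mnp n A -> Mnp n B -> Mnp n (A + B).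
Proof.
move=> [a Aa] [b Bb]; exists (a + b) => k l i j.
have -> : (A + B) (k * n + i)%N (l * n + j)%N =
  A (k * n + i)%N (l * n + j)%N + B (k * n + i)%N (l * n + j)%N by [].
by rewrite Aa Bb; case: eqP; rewrite ?mxE ?addr0.
Qed.

Lemma Mnp_opp n A : Mnp n A -> Mnp n (- A).
Proof.
move=> [a Aa]; exists (- a) => k l i j.
have -> : (- A) (k * n + i)%N (l * n + j)%N = - A (k * n + i)%N (l * n + j)%N.
  by [].
by rewrite Aa; case: eqP; rewrite ?mxE ?oppr0.
Qed.

Lemma Mnp_map n (f : F -> F) A : f 0 = 0 -> Mnp n A -> Mnp n (nmx_map f A).
Proof.
move=> f0 [a Aa]; exists (map_mx f a) => k l i j.
by rewrite /nmx_map Aa; case: eqP; rewrite ?mxE ?f0.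
Qed.

Lemma Mnp_tr n A : Mnp n A -> Mnp n (nmx_tr A).
Proof. by move=> [a Aa]; exists a^T => k l i j; rewrite /nmx_tr Aa eq_sym mxE. Qed.

Lemma Mnp1 n : (0 < n)%N -> Mnp n nmx1.
Proof. by case: n => // n _; apply/MnpP; exists 1%:M; rewrite nmx_diag1. Qed.

Lemma Mnp_mul n A B : (0 < n)%N -> Mnp n A -> Mnp n B -> Mnp n (nmx_mul A B).
Proof.
case: n => // n _ /MnpP[a ->] /MnpP[b ->].
by apply/MnpP; exists (a *m b); rewrite nmx_diagM.
Qed.

Lemma nmx_trM A B : nmx_tr (nmx_mul A B) = nmx_mul (nmx_tr B) (nmx_tr A).
Proof.
apply/funext => i; apply/funext => j; rewrite /nmx_tr /nmx_mul.
by apply: eq_fsbigr => k _; rewrite mulrC.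
Qed.

Lemma nmx_tr1 : nmx_tr nmx1 = nmx1.
Proof. by apply/funext => i; apply/funext => j; rewrite /nmx_tr /nmx1 eq_sym. Qed.

Variable s : steinitz.

Lemma Msp_common2 A B : Msp s A -> Msp s B ->
  exists n, [/\ (0 < n)%N, pos_divisors s n, Mnp n A & Mnp n B].
Proof.
move=> [m ms mA] [n ns nB]; have mns := pos_divisors_lcm ms ns.
have [mn0 _] := mns; exists (lcmn m n); split=> //.
  by apply: Mnp_dvd mA => //; apply: dvdn_lcml.
by apply: Mnp_dvd nB => //; apply: dvdn_lcmr.
Qed.

Lemma Msp_common3 A B C : Msp s A -> Msp s B -> Msp s C ->
  exists n (a b c : 'M[F]_n.+1),
    [/\ A = nmx_diag a, B = nmx_diag b & C = nmx_diag c].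
Proof.
move=> sA sB [p ps pC]; have [n [n0 ns nA nB]] := Msp_common2 sA sB.
have [l0 _] := pos_divisors_lcm ns ps.
have := Mnp_dvd l0 (dvdn_lcml _ _) nA; have := Mnp_dvd l0 (dvdn_lcml _ _) nB.
have := Mnp_dvd l0 (dvdn_lcmr _ _) pC.
case: (lcmn n p) l0 => // m _ /MnpP[c ->] /MnpP[b ->] /MnpP[a ->].
by exists m, a, b, c.
Qed.

Lemma Msp1 : Msp s nmx1.
Proof. by exists 1%N; [apply: pos_divisors1 | apply: Mnp1]. Qed.

Lemma Msp_mul A B : Msp s A -> Msp s B -> Msp s (nmx_mul A B).
Proof.
by move=> sA sB; have [n [n0 ns *]] := Msp_common2 sA sB; exists n => //;
  apply: Mnp_mul.
Qed.

Lemma Msp_map (f : F -> F) A : f 0 = 0 -> Msp s A -> Msp s (nmx_map f A).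
Proof. by move=> f0 [n ns nA]; exists n => //; apply: Mnp_map. Qed.

Lemma Msp_zmod_closed : zmod_closed [pred A : nmatrix F | A \in Msp s].
Proof.
split=> [|A B]; rewrite !inE.
  exists 1%N; first exact: pos_divisors1.
  by exists 0 => k l i j; rewrite mxE if_same.
move=> sA sB; have [n [n0 ns nA nB]] := Msp_common2 sA sB.
by exists n => //; apply: Mnp_add => //; apply: Mnp_opp.
Qed.

Lemma nmx_mulA : {in Msp s & &, associative nmx_mul}.
Proof.
move=> A B C /set_mem sA /set_mem sB /set_mem sC.
have [n [a [b [c [-> -> ->]]]]] := Msp_common3 sA sB sC.
by rewrite !nmx_diagM mulmxA.
Qed.

Lemma nmx_mul1 A : Msp s A -> nmx_mul nmx1 A = A.
Proof.
move=> sA; have [n [a [_ [_ [-> _ _]]]]] := Msp_common3 sA sA sA.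
by rewrite -(nmx_diag1 n) nmx_diagM mul1mx.
Qed.

Lemma nmx_mulr1 A : Msp s A -> nmx_mul A nmx1 = A.
Proof.
move=> sA; have [n [a [_ [_ [-> _ _]]]]] := Msp_common3 sA sA sA.
by rewrite -(nmx_diag1 n) nmx_diagM mulmx1.
Qed.

Lemma nmx_diagD n (a b : 'M[F]_n.+1) :
  nmx_diag (a + b) = (nmx_diag a + nmx_diag b : nmatrix F).
Proof.
apply/funext => i; apply/funext => j.
rewrite -[RHS]/(nmx_diag a i j + nmx_diag b i j) /nmx_diag mxE.
by case: eqP; rewrite ?addr0.
Qed.

Lemma nmx_mulDl A B C : Msp s A -> Msp s B -> Msp s C ->
  nmx_mul (A + B) C = nmx_mul A C + nmx_mul B C.
Proof.
move=> sA sB sC; have [n [a [b [c [-> -> ->]]]]] := Msp_common3 sA sB sC.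
by rewrite -nmx_diagD !nmx_diagM mulmxDl nmx_diagD.
Qed.

Lemma nmx_mulDr A B C : Msp s A -> Msp s B -> Msp s C ->
  nmx_mul A (B + C) = nmx_mul A B + nmx_mul A C.
Proof.
move=> sA sB sC; have [n [a [b [c [-> -> ->]]]]] := Msp_common3 sA sB sC.
by rewrite -nmx_diagD !nmx_diagM mulmxDr nmx_diagD.
Qed.

Lemma nmx_mapZ_diag n (c : F) (a : 'M[F]_n.+1) :
  nmx_map ( *%R c) (nmx_diag a) = nmx_diag (c *: a).
Proof.
apply/funext => i; apply/funext => j; rewrite /nmx_map /nmx_diag mxE.
by case: eqP; rewrite ?mulr0.
Qed.

Lemma nmx_mulZl (c : F) A B : Msp s A -> Msp s B ->
  nmx_map ( *%R c) (nmx_mul A B) = nmx_mul (nmx_map ( *%R c) A) B.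
Proof.
move=> sA sB; have [n [a [b [_ [-> -> _]]]]] := Msp_common3 sA sB sB.
by rewrite nmx_mapZ_diag !nmx_diagM nmx_mapZ_diag scalemxAl.
Qed.

Lemma nmx_mulZr (c : F) A B : Msp s A -> Msp s B ->
  nmx_map ( *%R c) (nmx_mul A B) = nmx_mul A (nmx_map ( *%R c) B).
Proof.
move=> sA sB; have [n [a [b [_ [-> -> _]]]]] := Msp_common3 sA sB sB.
by rewrite nmx_mapZ_diag !nmx_diagM nmx_mapZ_diag scalemxAr.
Qed.

Lemma GLsp_Msp A : GLsp s A -> Msp s A.
Proof. by move=> [n ns [nA _]]; exists n. Qed.

Lemma GLsp_inv A : GLsp s A ->
  exists B, [/\ GLsp s B, nmx_mul A B = nmx1 & nmx_mul B A = nmx1].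
Proof.
move=> [n ns [nA [B [nB AB BA]]]]; exists B; split=> //.
by exists n => //; split=> //; exists A.
Qed.

Lemma GLsp1 : GLsp s nmx1.
Proof.
exists 1%N; first exact: pos_divisors1.
have M1 := @Mnp1 1 isT; split=> //.
by exists nmx1; split=> //; apply: nmx_mul1 Msp1.
Qed.

Lemma GLnp_dvd n m A : (0 < m)%N -> (n %| m)%N -> GLnp n A -> GLnp m A.
Proof.
move=> m0 nm [nA [B [nB AB BA]]]; split; first exact: Mnp_dvd nA.
by exists B; split=> //; apply: Mnp_dvd nB.
Qed.

Lemma GLsp_mul A B : GLsp s A -> GLsp s B -> GLsp s (nmx_mul A B).
Proof.
move=> [m ms mA] [n ns nB]; have mns := pos_divisors_lcm ms ns.
have [l0 _] := mns; exists (lcmn m n) => //; set l := lcmn m n in l0 mns *.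
have [lA [A' [lA' AA' A'A]]] := GLnp_dvd l0 (dvdn_lcml m n) mA.
have [lB [B' [lB' BB' B'B]]] := GLnp_dvd l0 (dvdn_lcmr m n) nB.
have sl D : Mnp l D -> Msp s D by exists l.
have mS D : Mnp l D -> D \in Msp s by move=> /sl; rewrite inE.
split; first exact: Mnp_mul.
exists (nmx_mul B' A'); split; first exact: Mnp_mul.
- rewrite -nmx_mulA ?mS //; last exact: Mnp_mul.
  by rewrite (@nmx_mulA B) ?mS // BB' (nmx_mul1 (sl _ lA')).
- rewrite -nmx_mulA ?mS //; last exact: Mnp_mul.
  by rewrite (@nmx_mulA A') ?mS // A'A (nmx_mul1 (sl _ lB)).
Qed.

Lemma GLsp_tr A : GLsp s A -> GLsp s (nmx_tr A).
Proof.
move=> [n ns [nA [B [nB AB BA]]]]; exists n => //; split; first exact: Mnp_tr.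
exists (nmx_tr B); split; first exact: Mnp_tr.
  by rewrite -nmx_trM BA nmx_tr1.
by rewrite -nmx_trM AB nmx_tr1.
Qed.

End NMatrix.

Record spmatrix (F : fieldType) (s : steinitz) := SPMatrix {
  spmx_val :> nmatrix F;
  _ : spmx_val \in Msp s
}.

Section SPMatrix.
Variables (F : fieldType) (s : steinitz).
Local Notation M := (spmatrix F s).
Implicit Types x y z : M.

HB.instance Definition _ := [isSub for @spmx_val F s].
HB.instance Definition _ := [Choice of M by <:].
HB.instance Definition _ :=
  GRing.SubChoice_isSubZmodule.Build _ _ M (@Msp_zmod_closed F s).

Lemma spmxP x : Msp s x. Proof. exact: set_mem (valP x). Qed.

Definition spmx1 : M := SPMatrix (mem_set (@Msp1 F s)).

Definition spmx_mul x y : M :=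
  SPMatrix (mem_set (Msp_mul (spmxP x) (spmxP y))).

Definition spmx_scale (c : F) x : M :=
  SPMatrix (mem_set (Msp_map (mulr0 c) (spmxP x))).

Lemma spmx_mulA : associative spmx_mul.
Proof. by move=> x y z; apply/val_inj/nmx_mulA; apply: valP. Qed.

Lemma spmx_mul1 : left_id spmx1 spmx_mul.
Proof. by move=> x; apply/val_inj/nmx_mul1/spmxP. Qed.

Lemma spmx_mulr1 : right_id spmx1 spmx_mul.
Proof. by move=> x; apply/val_inj/nmx_mulr1/spmxP. Qed.

Lemma spmx_mulDl : left_distributive spmx_mul +%R.
Proof. by move=> x y z; apply/val_inj/nmx_mulDl; apply: spmxP. Qed.

Lemma spmx_mulDr : right_distributive spmx_mul +%R.
Proof. by move=> x y z; apply/val_inj/nmx_mulDr; apply: spmxP. Qed.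

Lemma spmx1_neq0 : spmx1 != 0.
Proof.
apply/eqP => /(congr1 (fun x : M => spmx_val x 0%N 0%N)) /eqP.
by rewrite -[X in _ == X]/(0 : F) /= /nmx1 oner_eq0.
Qed.

HB.instance Definition _ := GRing.Zmodule_isNzRing.Build M
  spmx_mulA spmx_mul1 spmx_mulr1 spmx_mulDl spmx_mulDr spmx1_neq0.

Let spmx_ext x y : (forall i j, spmx_val x i j = spmx_val y i j) -> x = y.
Proof. by move=> E; apply/val_inj/funext => i; apply/funext => j; apply: E. Qed.

Lemma spmx_scaleA (a b : F) x :
  spmx_scale a (spmx_scale b x) = spmx_scale (a * b) x.
Proof. by apply: spmx_ext => i j; apply: mulrA. Qed.

Lemma spmx_scale1 : left_id 1 spmx_scale.
Proof. by move=> x; apply: spmx_ext => i j; apply: mul1r. Qed.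

Lemma spmx_scaleDr : right_distributive spmx_scale +%R.
Proof. by move=> c x y; apply: spmx_ext => i j; apply: mulrDr. Qed.

Lemma spmx_scaleDl x : {morph spmx_scale^~ x : a b / a + b}.
Proof. by move=> a b; apply: spmx_ext => i j; apply: mulrDl. Qed.

HB.instance Definition _ := GRing.Zmodule_isLmodule.Build F M
  spmx_scaleA spmx_scale1 spmx_scaleDr spmx_scaleDl.

Lemma spmx_scaleAl (c : F) x y : c *: (x * y) = (c *: x) * y.
Proof. by apply/val_inj/(@nmx_mulZl F s); apply: spmxP. Qed.

HB.instance Definition _ := GRing.Lmodule_isLalgebra.Build F M spmx_scaleAl.

Lemma spmx_scaleAr (c : F) x y : c *: (x * y) = x * (c *: y).
Proof. by apply/val_inj/(@nmx_mulZr F s); apply: spmxP. Qed.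

HB.instance Definition _ := GRing.Lalgebra_isAlgebra.Build F M spmx_scaleAr.

Definition spmx_map (tau : {rmorphism F -> F}) x : M :=
  SPMatrix (mem_set (Msp_map (rmorph0 tau) (spmxP x))).

End SPMatrix.

Definition commutator_subgroup (G : groupType) : set G :=
  smallest (fun A : set G => group_closed (mem A))
           [set g | exists x y : G, g = [~ x, y]%g].

Arguments commutator_subgroup : clear implicits.

Lemma commutator_subgroup_closed (G : groupType) :
  group_closed [pred g : G | g \in commutator_subgroup G].
Proof.
split=> [|x y]; rewrite !inE.
  by move=> A [[A1 _] _]; apply: set_mem.
move=> Cx Cy A [cA sA]; apply: set_mem.
by apply: cA.2; apply: mem_set; [apply: Cx | apply: Cy].
Qed.

Lemma commutator_subgroup_morph (G : groupType) (f : G -> G) :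
  {morph f : x y / (x * y)%g} ->
  forall g, g \in commutator_subgroup G -> f g \in commutator_subgroup G.
Proof.
move=> fM.
have f1 : f 1%g = 1%g.
  by apply: (@mulgI _ (f 1%g)); rewrite -fM !mulg1.
have fV x : f (x^-1)%g = ((f x)^-1)%g.
  by apply: (@mulgI _ (f x)); rewrite -fM !mulgV.
have [C1 CB] := commutator_subgroup_closed G.
move=> g; rewrite !inE => Cg.
apply: (Cg (f @^-1` commutator_subgroup G)); split.
  split; first by rewrite inE /= f1; move: C1; rewrite inE.
  move=> x y; rewrite !inE /= => Cx Cy; rewrite fM fV.
  by have := CB (f x) (f y); rewrite !inE; apply.
move=> _ [x [y ->]]; apply: sub_gen_smallest; exists (f x), (f y).
by rewrite /commg /conjg !fM !fV.
Qed.

Record spGL (F : fieldType) (s : steinitz) := SPGL {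
  spGL_val :> nmatrix F;
  _ : spGL_val \in GLsp s
}.

Section SPGL.
Variables (F : fieldType) (s : steinitz).
Local Notation GL := (spGL F s).
Implicit Types x y z : GL.

HB.instance Definition _ := [isSub for @spGL_val F s].
HB.instance Definition _ := [Choice of GL by <:].

Lemma spGLP x : GLsp s x. Proof. exact: set_mem (valP x). Qed.

Definition spGL_one : GL := SPGL (mem_set (@GLsp1 F s)).

Definition spGL_mul x y : GL :=
  SPGL (mem_set (GLsp_mul (spGLP x) (spGLP y))).

Lemma spGL_inv_ex x :
  exists y, spGL_mul y x = spGL_one /\ spGL_mul x y = spGL_one.
Proof.
have [B [sB AB BA]] := GLsp_inv (spGLP x).
by exists (SPGL (mem_set sB)); split; apply/val_inj.
Qed.

Definition spGL_inv x : GL := projT1 (cid (spGL_inv_ex x)).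

Definition spmx_of_GL x : spmatrix F s :=
  SPMatrix (mem_set (GLsp_Msp (spGLP x))).

Lemma spGL_mulA : associative spGL_mul.
Proof.
by move=> x y z; apply/val_inj/(@nmx_mulA F s); apply/mem_set/GLsp_Msp/spGLP.
Qed.

Lemma spGL_mul1 : left_id spGL_one spGL_mul.
Proof. by move=> x; apply/val_inj/(@nmx_mul1 F s)/GLsp_Msp/spGLP. Qed.

Lemma spGL_mulr1 : right_id spGL_one spGL_mul.
Proof. by move=> x; apply/val_inj/(@nmx_mulr1 F s)/GLsp_Msp/spGLP. Qed.

Lemma spGL_mulV : left_inverse spGL_one spGL_inv spGL_mul.
Proof. by move=> x; rewrite /spGL_inv; case: cid => y []. Qed.

Lemma spGL_mulrV : right_inverse spGL_one spGL_inv spGL_mul.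
Proof. by move=> x; rewrite /spGL_inv; case: cid => y []. Qed.

HB.instance Definition _ :=
  isGroup.Build GL spGL_mulA spGL_mul1 spGL_mulr1 spGL_mulV spGL_mulrV.

Definition spGL_tr x : GL := SPGL (mem_set (GLsp_tr (spGLP x))).

Definition contragredient x : GL := spGL_tr (x^-1)%g.

Lemma contragredientM : {morph contragredient : x y / (x * y)%g}.
Proof.
by move=> x y; rewrite /contragredient invgM; apply/val_inj/nmx_trM.
Qed.

Lemma contragredientK : involutive contragredient.
Proof.
have trM : {morph @spGL_tr : x y / (x * y)%g >-> (y * x)%g}.
  by move=> x y; apply/val_inj/nmx_trM.
have tr1 : spGL_tr 1%g = 1%g by apply/val_inj/nmx_tr1.
have trV x : spGL_tr (x^-1)%g = ((spGL_tr x)^-1)%g.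
  by apply: (@mulgI _ (spGL_tr x)); rewrite -trM mulVg tr1 mulgV.
by move=> x; rewrite /contragredient !trV invgK; apply/val_inj.
Qed.

End SPGL.

Record spSL (F : fieldType) (s : steinitz) := SPSL {
  spSL_val :> spGL F s;
  _ : spSL_val \in commutator_subgroup (spGL F s)
}.

Section SPSL.
Variables (F : fieldType) (s : steinitz).
Local Notation SL := (spSL F s).

HB.instance Definition _ := [isSub for @spSL_val F s].
HB.instance Definition _ := [Choice of SL by <:].
HB.instance Definition _ := SubChoice_isSubGroup.Build _ _ SL
  (commutator_subgroup_closed (spGL F s)).

Definition psi (g : SL) : SL :=
  SPSL (commutator_subgroup_morph (@contragredientM F s) (valP g)).

Lemma psiK : involutive psi.
Proof. by move=> g; apply/val_inj/contragredientK. Qed.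

(* The groups of automorphisms below are sets of self-maps of [SL]. *)
Definition AutSL : set (SL -> SL) :=
  [set f | bijective f /\ {morph f : x y / (x * y)%g}].

(* As [psi] is an involution ([psiK]), its natural powers form the cyclic group
   that it generates. *)
Definition psi_group : set (SL -> SL) :=
  [set f | exists k : nat, f = iter k psi].

Definition restricts_to (phi : spmatrix F s -> spmatrix F s) (f : SL -> SL) :=
  forall g : SL, spmx_of_GL (f g) = phi (spmx_of_GL g).

Definition Aut_alg : set (SL -> SL) :=
  [set f | exists phi : {lrmorphism spmatrix F s -> spmatrix F s},
     bijective phi /\ restricts_to phi f].

Definition Aut_field : set (SL -> SL) :=
  [set f | exists tau : {rmorphism F -> F},
     bijective tau /\ restricts_to (spmx_map tau) f].

End SPSL.

Arguments AutSL : clear implicits.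
Arguments psi_group : clear implicits.
Arguments Aut_alg : clear implicits.
Arguments Aut_field : clear implicits.

Definition comp_set (T : Type) (X Y : set (T -> T)) : set (T -> T) :=
  [set f | exists x y, [/\ X x, Y y & f = x \o y]].

(* Main.v *)
(* Write [A = M_s^p(F)] and [G = SL_s^p(F)].  For [x] in [A] with [x ^ 2 = 0],
   [1 + x] lies in [G] and the centralizer in [A] of the centralizer of [1 + x]
   in [G] is [F + F x].  If [g] is the image of [1 + x] under an automorphism [f]
   of [G], some power of [g] is a nontrivial unipotent [1 + y]: in characteristic
   [p] because [g ^ p = 1], in characteristic [0] because [g] is conjugate to
   [g ^ 4], so that its eigenvalues are roots of unity.  The last nonzero power
   [z] of [y] has square zero, [1 + z] has the same centralizer as [g], so
   [g] lies in [F + F z], and conjugacy of [g] to [g ^ 4] and to [g ^ 9] yields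
   [f (1 + x) = 1 + phi x] with [(phi x) ^ 2 = 0].  The map [phi] is additive on
   orthogonal pairs and satisfies [phi (x y) = phi x phi y - phi y phi x] when
   [y x = 0].

   Take matrix units [E i j], [i, j < n], in [A] for some [n > 1] dividing [s].
   If [n > 2], the products [phi x phi y] and [phi y phi x] with [x], [y] in
   consecutive off-diagonal blocks annihilate each other, and as [A] is prime one
   of the two families vanishes; composing [f] with [psi] exchanges them.  When
   the second family vanishes, [phi] is multiplicative on off-diagonal blocks and
   extends to a ring automorphism of [A].  If [s = 2], the braid relation of
   [SL_2] and conjugation by diagonal matrices do the same.  A ring automorphism
   of [A] acts on the center [F] by a field automorphism, which is factored out
   to leave an [F]-algebra automorphism. *)
From HB Require Import structures.
Require Import Defs.
From mathcomp Require Import all_boot all_order all_algebra.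
From mathcomp Require Import all_classical.
From mathcomp Require Import fieldext.

Set Implicit Arguments.
Unset Strict Implicit.
Unset Printing Implicit Defensive.

Import GRing.Theory.
Local Open Scope ring_scope.
Local Open Scope classical_set_scope.

(** * Square-zero matrices *)

(** A form of the relation that still rewrites after [mulrA] has associated the whole product to the
    left. *)
Lemma mulr_pre2 (R : pzRingType) (x y t : R) : x * y = t ->
  forall a, a * x * y = a * t.
Proof. by move=> <- a; rewrite mulrA. Qed.

Lemma mulr_pre3 (R : pzRingType) (x y z t : R) : x * y * z = t ->
  forall a, a * x * y * z = a * t.
Proof. by move=> <- a; rewrite !mulrA. Qed.

Lemma sl2_pair (R : pzRingType) (x w : R) : x * x = 0 -> x * w * x = x ->
  exists y, [/\ x * y * x = x, y * x * y = y & y * y = 0].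
Proof.
move=> xx xwx; have xwxE := (xwx, mulr_pre3 xwx); have xxE := (xx, mulr_pre2 xx).
(* With [v = w x w] this is [v - v^2 x = v (1 - v x)]. Since [v x v = v], the factor [(1 - v x) v]
   vanishes, which makes the square zero. *)
exists (w * x * w - w * x * w * w * x * w * x); split.
- by rewrite mulrBr mulrBl !mulrA !xwxE !xxE !(mulr0, mul0r) subr0.
- by rewrite !(mulrBl, mulrBr) !mulrA !xwxE !xxE !(mulr0, mul0r) !subr0.
- by rewrite !(mulrBl, mulrBr) !mulrA !xwxE subrr.
Qed.

Section MatrixAlgebra.
Variables (F : fieldType) (m : nat).
Local Notation M := 'M[F]_m.+1.
Implicit Types a b c e g h w x y : M.

Lemma mx_regular x : exists w, x * w * x = x.
Proof. by exists (pinvmx x); rewrite -!mulmxE mulmxKpV. Qed.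

Lemma mul_delta_mx_entry a b i j k l : (a * delta_mx j k * b) i l = a i j * b k l.
Proof.
rewrite -!mulmxE mxE (bigD1 k) //= big1 => [|p pk]; last first.
  rewrite mxE big1 ?mul0r // => q _; rewrite mxE.
  by rewrite (negPf pk) andbF mulr0.
rewrite addr0 mxE (bigD1 j) //= big1 => [|q qj]; last first.
  by rewrite mxE (negPf qj) mulr0.
by rewrite mxE !eqxx mulr1 addr0.
Qed.

(** For [x] the matrix unit at [j, k] the hypothesis reads [a_ij b_kl = b_ij a_kl], so a nonzero
    entry of [b] determines the ratio. *)
Lemma mx_martindale a b : (forall x, a * x * b = b * x * a) -> b != 0 ->
  exists c : F, a = c *: b.
Proof.
move=> ab /matrix0Pn[k [l bkl]]; exists (a k l / b k l).
apply/matrixP => i j; have := congr1 (fun z : M => z i l) (ab (delta_mx j k)).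
rewrite !mul_delta_mx_entry mxE => e.
by rewrite mulrAC [a k l * _]mulrC -e mulfK.
Qed.

Lemma mx_prime a b : (forall x, a * x * b = 0) -> a = 0 \/ b = 0.
Proof.
move=> ab; have [->|/matrix0Pn[k [l bkl]]] := eqVneq b 0; [by right|left].
apply/matrixP => i j; have := congr1 (fun z : M => z i l) (ab (delta_mx j k)).
by rewrite mul_delta_mx_entry !mxE => /eqP; rewrite mulf_eq0 (negPf bkl) orbF => /eqP.
Qed.

Lemma delta_mx_sandwich a i j k l :
  delta_mx i j * a * delta_mx k l = a j k *: delta_mx i l.
Proof.
apply/matrixP => p q.
rewrite -[_ * delta_mx k l in LHS]mulr1 mul_delta_mx_entry -mulmxE mxE (bigD1 j) //=.
rewrite big1 => [|r rj]; last by rewrite mxE (negPf rj) andbF mul0r.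
rewrite !mxE !eqxx andbT addr0 (eq_sym l q).
by case: (p == i); case: (q == l); rewrite ?mulr1 ?mulr0 ?mul1r ?mul0r.
Qed.

(** The compression [e E_ij e] of a matrix unit has rank one, and its square is [e_ji] times itself;
    a nonzero entry [e_ji] allows it to be normalized to an idempotent. *)
Lemma mx_rank1_idempotent e : e * e = e -> e != 0 ->
  exists g, [/\ g != 0, g * g = g, e * g = g, g * e = g &
    forall b, exists c : F, g * b * g = c *: g].
Proof.
move=> ee /matrix0Pn[j [i eji]]; pose g : M := (e j i)^-1 *: (e * delta_mx i j * e).
have gbg b : g * b * g = ((e j i)^-1 * (e * b * e) j i) *: g.
  rewrite /g -!mulmxE -!(scalemxAl, scalemxAr) !mulmxE -scalerA; congr (_ *: _).
  rewrite scalerA mulrC -scalerA; congr (_ *: _).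
  have := congr1 (fun z => e * z * e) (delta_mx_sandwich (e * b * e) i j i j).
  by rewrite -!mulmxE -!(scalemxAl, scalemxAr) !mulmxE !mulrA.
have eg : e * g = g by rewrite /g -!mulmxE -!scalemxAr !mulmxE !mulrA ee.
have ge : g * e = g by rewrite /g -!mulmxE -!scalemxAl !mulmxE -!mulrA ee.
have gji : g j i = e j i by rewrite mxE mul_delta_mx_entry mulKf.
exists g; split=> //.
- by apply/matrix0Pn; exists j, i; rewrite gji.
- by rewrite -{1}[g]mulr1 gbg mulr1 ee mulVf // scale1r.
- by move=> b; exists ((e j i)^-1 * (e * b * e) j i).
Qed.

(* If [k] commutes with the square-zero elements of the corner [e M e], it
   commutes with a rank one idempotent [g <= e] and with [(e - g) M g]. *)
Lemma mx_corner_scalar e k : e * e = e -> e * k = k -> k * e = k ->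
  (forall y, e * y = y -> y * e = y -> y * y = 0 -> k * y = y * k) ->
  exists c : F, k = c *: e.
Proof.
move=> ee ek ke kC; have [e0|e_neq0] := eqVneq e 0.
  by exists 0; rewrite -ek e0 mul0r scaler0.
have [g [g0 gg eg ge gMg]] := mx_rank1_idempotent ee e_neq0.
have [c gkg] := gMg k; pose f := e - g.
have fg : f * g = 0 by rewrite mulrBl eg gg subrr.
have gf : g * f = 0 by rewrite mulrBr ge gg subrr.
have ef : e * f = f by rewrite mulrBr ee eg.
have fe : f * e = f by rewrite mulrBl ee ge.
have kgf b : k * (g * b * f) = g * b * f * k.
  apply: kC; first by rewrite !mulrA eg.
    by rewrite -mulrA fe.
  by rewrite !mulrA -[g * b * f * g]mulrA fg mulr0 !mul0r.
have kfg b : k * (f * b * g) = f * b * g * k.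
  apply: kC; first by rewrite !mulrA ef.
    by rewrite -mulrA ge.
  by rewrite !mulrA -[f * b * g * f]mulrA gf mulr0 !mul0r.
have kg : k * g = c *: g.
  have : f * k * g = 0.
    have [b|//|f0] := @mx_prime (f * k * g) f; last by rewrite f0 !mul0r.
    rewrite -!mulrA [g * (b * f)]mulrA kgf -!mulrA [f * (g * _)]mulrA fg.
    by rewrite mul0r.
  by rewrite !mulrBl ek gkg => /eqP; rewrite subr_eq0 => /eqP.
have gk : g * k = c *: g.
  have : g * (k * f) = 0.
    have [b||f0] := @mx_prime f (g * (k * f)); [|by move=> ->; rewrite !mulr0|].
      rewrite !mulrA -kfg -!mulrA gf !mulr0 //.
    done.
  by rewrite !mulrBr ke mulrA gkg => /eqP; rewrite subr_eq0 => /eqP.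
(* By primeness it suffices that [k - c e] kills every [e b g], which splits into [g b g] and
   [f b g]. *)
exists c; apply/eqP; rewrite -subr_eq0; apply/eqP.
have [b|//|/eqP] := @mx_prime (k - c *: e) g; last by rewrite (negPf g0).
have eE : e * b * g = g * b * g + f * b * g by rewrite -!mulrDl addrC subrK.
have -> : (k - c *: e) * b * g = k * (e * b * g) - c *: (e * b * g).
  by rewrite !mulrBl !mulrA ke -!mulmxE -!scalemxAl.
rewrite eE mulrDr kfg -[f * b * g * k]mulrA gk !mulrA kg.
by rewrite -!mulmxE -!(scalemxAl, scalemxAr) scalerDr subrr.
Qed.

(** First [h x = x h = c x]. Then [h1 = h - c] annihilates [x] on both sides, so it is confined to
    the corner [xw M wx], where [mx_corner_scalar] makes [h1 w] a multiple of the idempotent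
    [x w]. *)
Lemma mx_bicommutant x h : x * x = 0 -> x != 0 ->
  (forall y, y * y = 0 -> x * y = y * x -> h * y = y * h) ->
  exists c d : F, h = c *: 1 + d *: x.
Proof.
move=> xx x0 hC; have [w0 xw0x] := mx_regular x.
have [w [xwx wxw ww]] := sl2_pair xx xw0x.
have xwxE := (xwx, mulr_pre3 xwx); have wxwE := (wxw, mulr_pre3 wxw).
have xxE a : a * x * x = 0 by rewrite -mulrA xx mulr0.
have h_x a : h * (x * a * x) = x * a * x * h.
  by apply: hC; rewrite !mulrA ?xxE ?xx ?mul0r.
have [c hx] : exists c : F, h * x = c *: x.
  (* Martindale's identity for [h x w] and [x w] is available only after right multiplication by
     [b x]; primeness cancels that factor. *)
  have hxw a b : h * x * w * a * (x * w) * b * x = x * w * a * (h * x * w) * b * x.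
    transitivity (x * w * a * (h * (x * (w * b) * x))); last by rewrite !mulrA.
    by rewrite h_x; have := h_x (w * a * x * w * b); rewrite !mulrA.
  have [b||c hxw_c] := @mx_martindale (h * x * w) (x * w).
  - have [b2||/eqP] := @mx_prime (h * x * w * b * (x * w) - x * w * b * (h * x * w)) x.
    + by rewrite !mulrBl hxw subrr.
    + by move/eqP; rewrite subr_eq0 => /eqP.
    + by rewrite (negPf x0).
  - by apply: contra_neq x0 => xw0; rewrite -xwx xw0 mul0r.
  exists c; have := congr1 (fun z => z * x) hxw_c.
  by rewrite -mulmxE -scalemxAl !mulmxE !xwxE.
have xh : x * h = c *: x.
  have [a||/eqP] := @mx_prime x (x * h - c *: x); last 1 first.
  - by rewrite subr_eq0 => /eqP.
  - rewrite mulrBr !mulrA -h_x !mulrA hx.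
    by rewrite -!mulmxE -!(scalemxAl, scalemxAr) subrr.
  - by move/eqP; rewrite (negPf x0).
pose h1 := h - c *: 1; have hE : h = h1 + c *: 1 by rewrite subrK.
have h1C y : y * y = 0 -> x * y = y * x -> h1 * y = y * h1.
  move=> yy xy; rewrite mulrBl mulrBr hC //.
  by rewrite -!mulmxE -!(scalemxAl, scalemxAr) !mulmxE mulr1 mul1r.
have h1x : h1 * x = 0 by rewrite mulrBl hx -mulmxE -scalemxAl mulmxE mul1r subrr.
have xh1 : x * h1 = 0 by rewrite mulrBr xh -mulmxE -scalemxAr mulmxE mulr1 subrr.
(* [f] is the idempotent complementary to [x w] and [w x]. The elements [x a f] and [f a x] are
   square-zero and have zero product with [x] on both sides, so [h1] commutes with them. *)
clearbody h1; pose f := 1 - x * w - w * x.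
have fx : f * x = 0 by rewrite !mulrBl mul1r xwx subrr xxE subr0.
have xf : x * f = 0 by rewrite !mulrBr mulr1 !mulrA xwx xx mul0r subr0 subrr.
have fh1 : f * h1 = 0.
  have [a|/eqP|//] := @mx_prime x (f * h1); last by rewrite (negPf x0).
  rewrite mulrA -h1C ?mulrA ?h1x ?mul0r //.
    by rewrite -[x * a * f * x]mulrA fx mulr0 !mul0r.
  by rewrite xx !mul0r -[RHS]mulrA fx mulr0.
have h1f : h1 * f = 0.
  have [a|//|/eqP] := @mx_prime (h1 * f) x; last by rewrite (negPf x0).
  rewrite -[_ * a * x]mulrA -[_ * f * _]mulrA h1C ?(mulrA f) -?[f * a * x * h1]mulrA ?xh1 ?mulr0 //.
    by rewrite !mulrA -[f * a * x * f]mulrA xf mulr0 !mul0r.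
  by rewrite !mulrA xf !mul0r -[RHS]mulrA xx mulr0.
have h1l : h1 = x * w * h1.
  apply/eqP; rewrite -subr_eq0 -[X in X - _]mul1r -mulrBl -[1 - _](subrK (w * x)).
  by rewrite mulrDl fh1 add0r -mulrA xh1 mulr0.
have h1r : h1 = h1 * w * x.
  apply/eqP; rewrite -subr_eq0 -[X in X - _]mulr1 -mulrA -mulrBr.
  have -> : 1 - w * x = f + x * w by rewrite addrAC subrK.
  by rewrite mulrDr h1f add0r mulrA h1x mul0r.
have [d h1w] : exists d : F, h1 * w = d *: (x * w).
  apply: mx_corner_scalar; rewrite ?mulrA ?xwx -?h1l //.
    by rewrite -!mulrA (mulrA w) wxw.
  move=> y xwy yxw yy.
have xy : x * y = 0 by rewrite -xwy !mulrA xx !mul0r.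
  have yw : y * w = 0 by rewrite -yxw -!mulrA ww !mulr0.
  have h1y : h1 * y = 0 by rewrite -xwy !mulrA h1x !mul0r.
  (* A square-zero [y] in the corner of [x w] need not commute with [x]; adding its copy [w y x] in
     the corner of [w x] repairs this. *)
  have /(congr1 (fun z => z * w)) : h1 * (y + w * y * x) = (y + w * y * x) * h1.
    apply: h1C.
      rewrite mulrDl !mulrDr yy !mulrA yw !mul0r !add0r -[w * y * x * y]mulrA xy.
      by rewrite mulr0 add0r -!mulrA (mulrA x) (mulrA (x * w)) xwy (mulrA y) yy mul0r mulr0.
    by rewrite mulrDr mulrDl !mulrA xy add0r xwy xxE addr0.
  by rewrite mulrDr h1y add0r mulrDl -[w * y * x * h1]mulrA xh1 mulr0 addr0 -!mulrA yxw.
exists c, d; rewrite hE addrC; congr (_ + _).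
by rewrite h1r h1w -mulmxE -scalemxAl mulmxE xwx.
Qed.

End MatrixAlgebra.

(** * Matrices conjugate to their fourth power *)

Lemma eigenvalue_conj_exp4 (L : fieldType) m (g h : 'M[L]_m.+1) (z : L) :
  h \in unitmx -> h * g = g ^+ 4 * h -> eigenvalue g z -> eigenvalue g (z ^+ 4).
Proof.
move=> hU hg /eigenvalueP[v vg v0]; apply/eigenvalueP; exists (v *m h).
  have vgk k : v *m g ^+ k = z ^+ k *: v.
    elim: k => [|k IHk]; first by rewrite !expr0 mulmx1 scale1r.
    by rewrite !exprSr -mulmxE mulmxA IHk -scalemxAl vg scalerA.
  by rewrite -mulmxA (hg : h *m g = _) -mulmxE mulmxA vgk scalemxAl.
by apply: contra_neq v0 => vh0; rewrite -[v](mulmxK hU) vh0 mul0mx.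
Qed.

(** All of [z, z^4, z^16, ...] are roots of the characteristic polynomial, so two of them
    coincide. *)
Lemma eigenvalue_conj_exp4_unity (L : fieldType) m (g h : 'M[L]_m.+1) (z : L) :
  h \in unitmx -> g \in unitmx -> h * g = g ^+ 4 * h -> eigenvalue g z ->
  exists2 N, (0 < N)%N & z ^+ N = 1.
Proof.
move=> hU gU hg gz.
have z0 : z != 0.
  apply: contraTneq gz => ->; apply/eigenvalueP => -[v vg]; apply/negP/negPn.
  by rewrite -[v](mulmxK gU) vg scale0r mul0mx.
have gzr r : root (char_poly g) (z ^+ (4 ^ r)).
  rewrite -eigenvalue_root_char; elim: r => [|r IHr]; first by rewrite expr1.
  by rewrite expnSr exprM; apply: eigenvalue_conj_exp4 hU hg IHr.
have p0 : char_poly g != 0 by rewrite monic_neq0 ?char_poly_monic.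
pose rs := [seq z ^+ (4 ^ r) | r <- iota 0 (size (char_poly g))].
have [Urs|] := boolP (uniq rs).
  have /(max_poly_roots p0)/(_ Urs) : all (root (char_poly g)) rs.
    by apply/allP => _ /mapP[r _ ->].
  by rewrite size_map size_iota ltnn.
move=> /(uniqPn 0)[i [j [ij]]]; rewrite size_map size_iota => jp.
rewrite !(nth_map 0%N) ?size_iota ?(ltn_trans ij) // !nth_iota ?(ltn_trans ij) //.
rewrite !add0n => zij; exists (4 ^ j - 4 ^ i)%N.
  by rewrite subn_gt0 ltn_exp2l.
have zi : z ^+ (4 ^ i) != 0 by rewrite expf_neq0.
by apply: (mulfI zi); rewrite mulr1 -exprD subnKC // leq_exp2l // ltnW.
Qed.

Lemma irreducible_factor (F : fieldType) (p : {poly F}) : (1 < size p)%N ->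
  exists2 q, irreducible_poly q & q %| p.
Proof.
have [n] := ubnP (size p); elim: n p => // n IHn p pn p1.
have [pI|pnI] := EM (irreducible_poly p); first by exists p.
have [q [q1 qp qn]] : exists q : {poly F}, [/\ size q != 1%N, q %| p & ~~ (q %= p)].
  apply: contrapT => /forallNP qP; apply: pnI; split=> // q q1 qp.
  by apply: contrapT => /negP qn; apply: (qP q).
have p0 : p != 0 by apply: contraTneq p1 => ->; rewrite size_poly0.
have q0 : q != 0 by apply: contraTneq qp => ->; rewrite dvd0p.
have qltp : (size q < size p)%N.
  by rewrite ltn_neqAle dvdp_leq // andbT dvdp_size_eqp.
have [||r rI rq] := IHn q; last by exists r => //; apply: dvdp_trans qp.
- exact: leq_trans qltp _.
- by rewrite ltn_neqAle eq_sym q1 size_poly_gt0.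
Qed.

(** An irreducible factor of the minimal polynomial has a root in an extension field; this
    eigenvalue is a root of unity, so the factor divides some [X^N - 1]. Multiplying the factors
    together shows that the minimal polynomial divides a power of a single [X^N - 1]. *)
Lemma mx_power_unipotent (F : fieldType) m (g h : 'M[F]_m.+1) :
  h \in unitmx -> g \in unitmx -> h * g = g ^+ 4 * h ->
  exists N k, (0 < N)%N /\ (g ^+ N - 1) ^+ k = 0.
Proof.
move=> hU gU hg.
have irr q : irreducible_poly q -> q %| mxminpoly g ->
    exists2 N, (0 < N)%N & q %| 'X^N - 1.
  move=> qI qg; have [L _ [z qz _]] := irredp_FAdjoin qI.
  have gz : eigenvalue (map_mx (in_alg L) g) z.
    rewrite eigenvalue_root_min mxminpoly_map.
    by move: qg => /dvdpP[r ->]; rewrite rmorphM rootM qz orbT.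
  have hgL : map_mx (in_alg L) h * map_mx (in_alg L) g =
      map_mx (in_alg L) g ^+ 4 * map_mx (in_alg L) h.
    by rewrite -rmorphXn -!rmorphM hg.
  have [||N N0 zN] := eigenvalue_conj_exp4_unity _ _ hgL gz; rewrite ?map_unitmx //.
  exists N => //; apply: contraT; rewrite -irreducible_poly_coprime //.
  rewrite -(coprimep_map (in_alg L)) => /coprimep_root/(_ qz).
  by rewrite rmorphB /= map_polyXn rmorph1 !hornerE zN subrr eqxx.
have fac p : p != 0 -> p %| mxminpoly g ->
    exists N k, (0 < N)%N /\ p %| ('X^N - 1) ^+ k.
  have [n] := ubnP (size p); elim: n p => // n IHn p pn p0 pg.
  have [p1|] := leqP (size p) 1.
    exists 1%N, 0%N; split=> //; rewrite expr0.
    have : size p == 1%N by rewrite eqn_leq p1 size_poly_gt0.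
    by rewrite size_poly_eq1 => /eqp_dvdl->.
  move=> /irreducible_factor[q qI /dvdpP[r def_p]].
  have [q0 r0] : q != 0 /\ r != 0.
    by apply/andP; move: p0; rewrite def_p mulf_eq0 negb_or andbC.
  have q1 : (1 < size q)%N by case: qI.
  have [|//||N [k [N0 rk]]] := IHn r.
  - apply: (@leq_trans (size p)) => //; rewrite def_p size_mul // -subn1 -addnBA ?(ltnW q1) //.
    by rewrite -[X in (X < _)%N]addn0 ltn_add2l subn_gt0.
  - by apply: dvdp_trans pg; rewrite def_p dvdp_mulr.
  have [|N' N'0 qN'] := irr q qI.
    by apply: dvdp_trans pg; rewrite def_p dvdp_mull.
  have dvdX a b : ('X^a - 1 : {poly F}) %| 'X^(a * b) - 1.
    by rewrite exprM -{2}(expr1n _ b) subrXX dvdp_mulr.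
  exists (N * N')%N, k.+1; split; first by rewrite muln_gt0 N0.
  rewrite def_p exprSr dvdp_mul //; last first.
    by apply: dvdp_trans qN' _; rewrite mulnC dvdX.
  by apply: dvdp_trans rk _; rewrite dvdp_exp2r.
have [||N [k [N0]]] := fac (mxminpoly g); rewrite ?monic_neq0 ?mxminpoly_monic //.
move=> /mxminpoly_minP; rewrite rmorphXn rmorphB /= rmorph1 rmorphXn /= horner_mx_X.
by exists N, k.
Qed.

(** * Elementary matrices *)

Section Elementary.
Variable F : fieldType.

Definition transvection m (i j : 'I_m) (c : F) : 'M_m := 1%:M + c *: delta_mx i j.

(** Closure under products is enough: the inverse of a transvection is a transvection. *)
Inductive elementary m : 'M[F]_m -> Prop :=
| elementary1 : elementary 1%:M
| elementary_transvection i j c : i != j -> elementary (transvection i j c)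
| elementary_mul a b : elementary a -> elementary b -> elementary (a *m b).

Lemma transvectionK m (i j : 'I_m) c : i != j ->
  transvection i j c *m transvection i j (- c) = 1%:M.
Proof.
move=> ij; rewrite /transvection mulmxDl mul1mx mulmxDr mulmx1 -scalemxAl.
rewrite -scalemxAr mul_delta_mx_cond eq_sym (negPf ij) !scaler0 addr0.
by rewrite scaleNr subrK.
Qed.

Lemma elementary_inv m (a : 'M[F]_m) : elementary a ->
  exists b, [/\ elementary b, a *m b = 1%:M & b *m a = 1%:M].
Proof.
elim=> {a} [|i j c ij|a b _ [a' [ea aa' a'a]] _ [b' [eb bb' b'b]]].
- by exists 1%:M; rewrite mulmx1; split=> //; apply: elementary1.
- exists (transvection i j (- c)); split; first exact: elementary_transvection.
    exact: transvectionK.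
  by rewrite -{2}[c]opprK transvectionK.
- exists (b' *m a'); split; first exact: elementary_mul.
    by rewrite mulmxA -(mulmxA a) bb' mulmx1.
  by rewrite mulmxA -(mulmxA b') a'a mulmx1.
Qed.

Lemma elementary_diag_conj m (a : 'M[F]_m) (v : 'rV_m) :
  elementary a -> (forall i, v 0 i != 0) ->
  exists2 b, elementary b & diag_mx v *m a = b *m diag_mx v.
Proof.
move=> ea v0; elim: ea => {a} [|i j c ij|a b _ [a' ea aa'] _ [b' eb bb']].
- by exists 1%:M; [exact: elementary1|rewrite mulmx1 mul1mx].
- exists (transvection i j (c * v 0 i / v 0 j)).
    exact: elementary_transvection.
  apply/matrixP => k l; rewrite mul_diag_mx mul_mx_diag !mxE.
  rewrite mulrDr mulrDl; congr (_ + _).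
    by case: eqP => [->|]; rewrite ?mulr0 ?mul0r // mulrC.
  case: eqP => [->|]; case: eqP => [->|]; rewrite ?mulr0 ?mul0r //= !mulr1.
  by rewrite divfK // mulrC.
- exists (a' *m b'); first exact: elementary_mul.
  by rewrite mulmxA aa' -mulmxA bb' mulmxA.
Qed.

Lemma elementary_block m (a : 'M[F]_m) :
  elementary a -> elementary (block_mx 1%:M 0 0 a : 'M_(1 + m)).
Proof.
elim=> {a} [|i j c ij|a b _ ea _ eb].
- by rewrite -scalar_mx_block; apply: elementary1.
- have -> : block_mx 1%:M 0 0 (transvection i j c) =
    transvection (rshift 1 i) (rshift 1 j) c.
    rewrite /transvection delta_mx_dshift delta_mx_rshift -[X in col_mx X]row_mx0.
    rewrite -/(block_mx _ _ _ _) scalar_mx_block scale_block_mx add_block_mx.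
    by rewrite !scaler0 !addr0.
  by apply: elementary_transvection; rewrite (inj_eq (@rshift_inj _ _)).
- have -> : block_mx 1%:M 0 0 (a *m b) =
    (block_mx 1%:M 0 0 a : 'M_(1 + m)) *m block_mx 1%:M 0 0 b.
    by rewrite mulmx_block !mulmx1 !mul0mx !mulmx0 !addr0 add0r.
  exact: elementary_mul.
Qed.

Lemma elementary_lower_block m (v : 'cV[F]_m) :
  elementary (block_mx 1%:M 0 v 1%:M : 'M_(1 + m)).
Proof.
rewrite [v]matrix_sum_delta.
elim/big_ind: _ => [|u w eu ew|i _]; first by rewrite -scalar_mx_block; apply: elementary1.
  have := elementary_mul eu ew.
  by rewrite mulmx_block !mulmx1 !mul1mx !mul0mx !mulmx0 !addr0 add0r.
elim/big_ind: _ => [|u w eu ew|j _]; first by rewrite -scalar_mx_block; apply: elementary1.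
  have := elementary_mul eu ew.
  by rewrite mulmx_block !mulmx1 !mul1mx !mul0mx !mulmx0 !addr0 add0r.
have -> : block_mx 1%:M 0 (v i j *: delta_mx i j) 1%:M =
  transvection (rshift 1 i) (lshift m j) (v i j).
  rewrite /transvection delta_mx_dshift delta_mx_lshift -[X in col_mx X]row_mx0.
  rewrite -/(block_mx _ _ _ _) scalar_mx_block scale_block_mx add_block_mx.
  by rewrite !scaler0 !addr0 add0r.
by apply: elementary_transvection; rewrite eq_rlshift.
Qed.

Lemma elementary_upper_block m (v : 'rV[F]_m) :
  elementary (block_mx 1%:M v 0 1%:M : 'M_(1 + m)).
Proof.
rewrite [v]matrix_sum_delta.
elim/big_ind: _ => [|u w eu ew|i _]; first by rewrite -scalar_mx_block; apply: elementary1.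
  have := elementary_mul ew eu.
  by rewrite mulmx_block !mulmx1 !mul1mx !mul0mx !mulmx0 !addr0 add0r.
elim/big_ind: _ => [|u w eu ew|j _]; first by rewrite -scalar_mx_block; apply: elementary1.
  have := elementary_mul ew eu.
  by rewrite mulmx_block !mulmx1 !mul1mx !mul0mx !mulmx0 !addr0 add0r.
have -> : block_mx 1%:M (v i j *: delta_mx i j) 0 1%:M =
  transvection (lshift m i) (rshift 1 j) (v i j).
  rewrite /transvection delta_mx_ushift delta_mx_rshift -[X in col_mx _ X]row_mx0.
  rewrite -/(block_mx _ _ _ _) scalar_mx_block scale_block_mx add_block_mx.
  by rewrite !scaler0 !addr0 add0r.
by apply: elementary_transvection; rewrite eq_lrshift.
Qed.

Lemma unitmx_pivot m (a : 'M[F]_(1 + m)) : a \in unitmx ->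
  exists2 t, elementary t & (t *m a) 0 0 != 0.
Proof.
move=> aU; have [a00|a00] := eqVneq (a 0 0) 0; last first.
  by exists 1%:M; [exact: elementary1|rewrite mul1mx].
have [i ai0] : exists i, a i 0 != 0.
  apply/existsP; apply: contraT => /existsPn a_0.
  have : col 0 a = 0 by apply/colP => i; rewrite !mxE; apply/eqP; rewrite -[_ == _]negbK.
  move/(congr1 (mulmx (invmx a))); rewrite colE mulmxA mulVmx // mul1mx mulmx0.
  by move/colP/(_ 0); rewrite !mxE !eqxx => /eqP; rewrite oner_eq0.
have i0 : 0 != i by apply: contra_neq ai0 => <-.
exists (transvection 0 i 1); first exact: elementary_transvection.
rewrite /transvection scale1r mulmxDl mul1mx mxE a00 add0r mxE (bigD1 i) //=.
rewrite big1 => [|k ki]; first by rewrite mxE !eqxx mul1r addr0.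
by rewrite mxE (negPf ki) andbF mul0r.
Qed.

(** Gaussian elimination: a transvection produces a nonzero pivot, block transvections clear its
    column and row, and induction handles the rest. *)
Lemma unitmx_elementary_diag m (a : 'M[F]_m) : a \in unitmx ->
  exists t (v : 'rV_m), [/\ elementary t, forall i, v 0 i != 0 & a = t *m diag_mx v].
Proof.
elim: m a => [|m IHm] a aU.
  exists 1%:M, 0; split; [exact: elementary1| by case|].
  by apply/matrixP => -[].
have [t et] := @unitmx_pivot m a aU; set b := t *m a => b00.
have [t' [et' tt' t't]] := elementary_inv et.
have bU : b \in unitmx by rewrite unitmx_mul aU andbT; case: (mulmx1_unit tt').
have -> : a = t' *m b by rewrite mulmxA t't mul1mx.
clearbody b.
have [p p0 ulb] : exists2 p : F, p != 0 & ulsubmx (b : 'M_(1 + m)) = p%:M.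
  by exists (b 0 0) => //; rewrite [LHS]mx11_scalar !mxE; congr (b _ _)%:M; apply: val_inj.
pose r := ursubmx (b : 'M_(1 + m)); pose c := dlsubmx (b : 'M_(1 + m)).
(* The Schur complement of the pivot [p]. *)
pose d := drsubmx (b : 'M_(1 + m)) - p^-1 *: (c *m r).
have bE : b = (block_mx 1%:M 0 (p^-1 *: c) 1%:M : 'M_(1 + m)) *m block_mx p%:M r 0 d.
  rewrite -[LHS](@submxK _ 1 m 1 m) ulb -/r -/c mulmx_block !mul1mx !mul0mx !addr0.
  by rewrite mul_mx_scalar scalerA mulfV // scale1r -scalemxAl addrC subrK.
have dU : d \in unitmx.
  move: bU; rewrite bE unitmx_mul => /andP[_]; rewrite !unitmxE det_ublock.
  by rewrite unitrM => /andP[].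
have [t1 [v [et1 v0 dE]]] := IHm d dU.
pose w : 'rV_(1 + m) := row_mx p%:M v.
have dw : diag_mx w = block_mx p%:M 0 0 (diag_mx v).
  rewrite /w diag_mx_row; congr (block_mx _ 0 0 _).
  by apply/matrixP => i j; rewrite !mxE !ord1 eqxx.
have block : block_mx p%:M r 0 d = (block_mx 1%:M (r *m invmx d) 0 1%:M : 'M_(1 + m))
    *m (block_mx 1%:M 0 0 t1 *m diag_mx w).
  rewrite dw !mulmx_block !mul1mx !mul0mx !mulmx0 !addr0 !add0r -dE.
  by rewrite mulmx0 addr0 mulmxKV.
exists (t' *m (block_mx 1%:M 0 (p^-1 *: c) 1%:M *m
   (block_mx 1%:M (r *m invmx d) 0 1%:M *m block_mx 1%:M 0 0 t1))), w; split.
- do 3?apply: elementary_mul => //.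
  + exact: elementary_lower_block.
  + exact: elementary_upper_block.
  + exact: elementary_block.
- move=> i; rewrite mxE; case: splitP => j _ //; rewrite mxE !ord1 eqxx mulr1n //.
- rewrite -!mulmxA bE; congr (_ *m (_ *m _)); exact: block.
Qed.

(** Modulo elementary matrices, which diagonal matrices normalize, every invertible matrix is
    diagonal, and diagonal matrices commute. Hence commutators are elementary. *)
Lemma unitmx_comm_mod_elementary m (a b : 'M[F]_m) :
  a \in unitmx -> b \in unitmx ->
  exists2 t, elementary t & a *m b = t *m (b *m a).
Proof.
move=> /unitmx_elementary_diag[t [v [et v0 ->]]].
move=> /unitmx_elementary_diag[t' [v' [et' v'0 ->]]].
have [s es sE] := elementary_diag_conj et' v0.
have [s' es' s'E] := elementary_diag_conj et v'0.
have [u [eu _ uE]] := elementary_inv (elementary_mul et' es').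
exists (t *m s *m u); first by do 2?apply: elementary_mul.
have -> : t' *m diag_mx v' *m (t *m diag_mx v) = t' *m s' *m (diag_mx v *m diag_mx v').
  by rewrite -!mulmxA (mulmxA (diag_mx v')) s'E -mulmxA (diag_mxC v).
rewrite (mulmxA (_ *m u)) -(mulmxA _ u) uE mulmx1 -!mulmxA (mulmxA (diag_mx v)) sE.
by rewrite -!mulmxA.
Qed.

End Elementary.

(** * Unipotents and automorphisms *)

Section SquareZero.
Variables (F : fieldType) (A : algType F).
Implicit Types (a b c d k : F) (x y z w : A).

Lemma square_zeroZ k x : x * x = 0 -> (k *: x) * (k *: x) = 0.
Proof. by move=> xx; rewrite -scalerAl -scalerAr xx !scaler0. Qed.

Lemma scalar_add_square_zero c x : x * x = 0 -> (c *: 1 + x) * (c *: 1 + x) = 0 -> c = 0.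
Proof.
move=> xx; rewrite mulrDl !mulrDr xx addr0 -!scalerAl -!scalerAr !mul1r mulr1 => cx.
apply/eqP; apply: contraT => c0; move: (cx) => /(congr1 (fun z => x * z)).
rewrite !mulrDr mulr0 -!scalerAr !mulr1 xx !scaler0 !addr0 => /eqP.
rewrite !scaler_eq0 (negPf c0) /= => /eqP x0.
by move/eqP: cx; rewrite x0 !scaler0 !addr0 !scaler_eq0 (negPf c0) /= oner_eq0.
Qed.

Lemma expr1D_square_zero x n : x * x = 0 -> (1 + x) ^+ n = 1 + n%:R *: x.
Proof.
move=> xx; elim: n => [|n IHn]; first by rewrite expr0 scale0r addr0.
rewrite exprSr IHn mulrDr mulr1 mulrDl mul1r -scalerAl xx scaler0 addr0.
by rewrite -addrA -[X in _ + (_ + X)]scale1r -scalerDl mulrSr.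
Qed.

Lemma exprD_scalar_square_zero c x n : x * x = 0 ->
  exists d, (c *: 1 + x) ^+ n = c ^+ n *: 1 + d *: x.
Proof.
move=> xx; elim: n => [|n [d IHn]].
  by exists 0; rewrite !expr0 scale1r scale0r addr0.
exists (c ^+ n + d * c); rewrite exprSr IHn mulrDr !mulrDl -!scalerAl -!scalerAr.
rewrite xx !mul1r !mulr1 !scaler0 addr0 !scalerA -exprSr scalerDl -!addrA.
by rewrite [X in _ + X]addrC.
Qed.

End SquareZero.

(** * Weyl and torus elements of a square-zero pair *)

Section Weyl.
Variables (F : fieldType) (A : algType F) (x w : A).
Hypotheses (xx : x * x = 0) (ww : w * w = 0).
Hypotheses (xwx : x * w * x = x) (wxw : w * x * w = w).

(** The matrix with off-diagonal entries [k] and [- k^-1] in the copy of two by two matrices spanned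
    by [x], [w], [x w], [w x], and the identity on the complementary idempotent [1 - x w - w x]. *)
Definition weyl (k : F) : A := 1 - x * w - w * x + k *: x - k^-1 *: w.

Lemma weylE k : k != 0 ->
  (1 + k *: x) * (1 + (- k^-1) *: w) * (1 + k *: x) = weyl k.
Proof.
move=> k0.
have -> : (1 + k *: x) * (1 + (- k^-1) *: w) = 1 + k *: x - k^-1 *: w - x * w.
  rewrite mulrDr mulr1 mulrDl mul1r -scalerAl -scalerAr scalerA mulrN mulfV //.
  by rewrite scaleN1r scaleNr addrA.
rewrite mulrDr mulr1 -scalerAr.
have -> : (1 + k *: x - k^-1 *: w - x * w) * x = - k^-1 *: (w * x).
  by rewrite !mulrBl mulrDl mul1r -!scalerAl xx xwx scaler0 addr0 addrAC subrr sub0r scaleNr.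
rewrite scalerA mulrN mulfV // scaleN1r /weyl.
by rewrite [LHS](ACl (1*4*5*2*3)%AC).
Qed.

Lemma weyl_x k : k != 0 -> weyl k * x = - (k^-1 ^+ 2) *: (w * weyl k).
Proof.
move=> k0; have -> : weyl k * x = - k^-1 *: (w * x).
  rewrite /weyl !(mulrBl, mulrDl) mul1r xwx subrr -mulrA xx mulr0 subr0.
  by rewrite -!scalerAl xx scaler0 addr0 sub0r scaleNr.
have -> : w * weyl k = k *: (w * x).
  rewrite /weyl !(mulrBr, mulrDr) mulr1 !mulrA wxw subrr ww mul0r subr0.
  by rewrite -!scalerAr ww scaler0 subr0 add0r.
by rewrite scalerA expr2 mulNr mulfVK.
Qed.

Lemma weyl_w k : k != 0 -> weyl k * w = - (k ^+ 2) *: (x * weyl k).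
Proof.
move=> k0; have -> : weyl k * w = k *: (x * w).
  rewrite /weyl !(mulrBl, mulrDl) mul1r wxw -mulrA ww mulr0 subr0 subrr.
  by rewrite -!scalerAl ww scaler0 subr0 add0r.
have -> : x * weyl k = - k^-1 *: (x * w).
  rewrite /weyl !(mulrBr, mulrDr) mulr1 !mulrA xx mul0r subr0 xwx subrr.
  by rewrite -!scalerAr xx scaler0 add0r sub0r scaleNr.
by rewrite scalerA mulrNN expr2 mulfK.
Qed.

(** The product acts as the torus element with entries [- k] and [- k^-1], so conjugation by it
    scales [x] by the ratio [k^2]. *)
Lemma weyl_scale k : k != 0 ->
  weyl k * weyl 1 * x = k ^+ 2 *: (x * (weyl k * weyl 1)).
Proof.
move=> k0; rewrite -mulrA weyl_x ?oner_neq0 // invr1 expr1n scaleN1r mulrN [weyl k * (w * _)]mulrA.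
by rewrite weyl_w // -scalerAl scaleNr opprK mulrA.
Qed.

End Weyl.

(** The properties of the special linear group inside the matrix algebra on which the argument
    rests. [U] is specified on square-zero elements only; elsewhere its values are arbitrary. *)
Record unipotent_embedding (F : fieldType) (A : algType F) (G : groupType)
    (io : G -> A) (U : A -> G) : Prop := UnipotentEmbedding {
  io_injective : injective io;
  io_one : io 1%g = 1;
  io_mul : forall g h : G, io (g * h)%g = io g * io h;
  io_unipotent : forall x, x * x = 0 -> io (U x) = 1 + x;
  ring_regular : forall x : A, exists w, x * w * x = x;
  ring_prime : forall a b : A, (forall x, a * x * b = 0) -> a = 0 \/ b = 0;
  ring_bicommutant : forall x h : A, x * x = 0 -> x != 0 ->
    (forall y, y * y = 0 -> x * y = y * x -> h * y = y * h) ->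
    exists c d : F, h = c *: 1 + d *: x;
  power_unipotent : forall g h : G, io h * io g = io g ^+ 4 * io h ->
    exists N k, (0 < N)%N /\ (io g ^+ N - 1) ^+ k = 0
}.

Definition peirce_block (F : fieldType) (A : algType F) n (E : 'I_n -> 'I_n -> A) i j x :=
  E i i * x * E j j = x.

(** Generation is as a monoid, and by unipotents with [x] ranging over whole Peirce blocks
    [E i i A E j j], which may be larger than the lines [F E i j]. *)
Record matrix_frame (F : fieldType) (A : algType F) (G : groupType) (U : A -> G)
    n (E : 'I_n -> 'I_n -> A) : Prop := MatrixFrame {
  frame_gt1 : (1 < n)%N;
  frame_mul : forall i j k l, E i j * E k l = if j == k then E i l else 0;
  frame_sum : \sum_i E i i = 1;
  frame_neq0 : forall i j, E i j != 0;
  frame_generates : forall P : G -> Prop, P 1%g ->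
    (forall g h, P g -> P h -> P (g * h)%g) ->
    (forall i j x, i != j -> peirce_block E i j x -> P (U x)) -> forall g, P g
}.

(** Linearity over [F] is not demanded: [Phi] may be semilinear for a field automorphism, which is
    split off at the end. *)
Definition extends_to_ring_automorphism (A : pzRingType) (G : Type) (io : G -> A)
    (f : G -> G) := exists Phi : A -> A,
  [/\ {morph Phi : a b / a + b}, {morph Phi : a b / a * b}, Phi 1 = 1,
    bijective Phi & forall g, io (f g) = Phi (io g)].

Section UnipotentGroup.
Variables (F : fieldType) (A : algType F) (G : groupType).
Variables (io : G -> A) (U : A -> G).
Implicit Types (x y z w : A).
Hypotheses (char2 : 2%N \notin [pchar F]) (char3 : 3%N \notin [pchar F]).
Hypothesis ax : unipotent_embedding io U.

Let io_inj := io_injective ax.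
Let io1 := io_one ax.
Let ioM := io_mul ax.
Let ioU := io_unipotent ax.
Let A_regular := ring_regular ax.
Let A_prime := ring_prime ax.
Let A_bicommutant := ring_bicommutant ax.
Let A_power_unipotent := power_unipotent ax.

Let nz2 : 2%:R != 0 :> F.
Proof. by move: char2; rewrite inE. Qed.

Let nz3 : 3%:R != 0 :> F.
Proof. by move: char3; rewrite inE. Qed.

Lemma ioX (g : G) n : io (g ^+ n)%g = io g ^+ n.
Proof.
by elim: n => [|n IHn]; rewrite ?expg0 ?io1 ?expr0 // expgS exprS ioM IHn.
Qed.

Lemma ioV (g : G) : io g * io (g^-1)%g = 1 /\ io (g^-1)%g * io g = 1.
Proof. by rewrite -!ioM mulgV mulVg io1. Qed.

Lemma commute_io (g h : G) : commute g h <-> io g * io h = io h * io g.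
Proof. by rewrite /commute -!ioM; split=> [->|/io_inj]. Qed.

Lemma commute_U (g : G) x : x * x = 0 -> commute g (U x) <-> io g * x = x * io g.
Proof.
move=> xx; rewrite commute_io ioU // mulrDr mulrDl mulr1 mul1r.
by split=> [/addrI|->].
Qed.

Lemma U0 : U 0 = 1%g.
Proof. by apply: io_inj; rewrite ioU ?mul0r // addr0 io1. Qed.

Lemma UX x n : x * x = 0 -> (U x ^+ n)%g = U (n%:R *: x).
Proof.
move=> xx; apply: io_inj.
by rewrite ioX !ioU ?square_zeroZ // expr1D_square_zero.
Qed.

Lemma square_zero_conj_scale x k : x * x = 0 -> k != 0 ->
  exists h : G, io h * x = k ^+ 2 *: (x * io h).
Proof.
move=> xx k0; have [w0 xwx0] := A_regular x.
have [w [xwx wxw ww]] := sl2_pair xx xwx0.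
pose W c := (U (c *: x) * U ((- c^-1) *: w) * U (c *: x))%g.
have ioW c : c != 0 -> io (W c) = weyl x w c.
  by move=> c0; rewrite !ioM !ioU ?square_zeroZ // weylE.
exists (W k * W 1%R)%g; rewrite ioM !ioW ?oner_neq0 //.
exact: weyl_scale.
Qed.

(** Conjugacy of an element to its own power is a property of the abstract group, hence inherited by
    the image under an automorphism. *)
Lemma U_conj_pow x (k : nat) : x * x = 0 -> k%:R != 0 :> F ->
  exists h : G, (h * U x = U x ^+ (k ^ 2) * h)%g.
Proof.
move=> xx k0; have [h hx] := square_zero_conj_scale xx k0.
exists h; apply: io_inj; rewrite !ioM ioX ioU // expr1D_square_zero //.
by rewrite mulrDr mulrDl mulr1 mul1r hx natrX -scalerAl.
Qed.

(* A central element [x] would satisfy [x = x w x = x x w = 0] for a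
   generalized inverse [w]. *)
Lemma square_zero_noncentral x : x * x = 0 ->
  (forall y, y * y = 0 -> x * y = y * x) -> x = 0.
Proof.
move=> xx xC; have [w0 xwx0] := A_regular x.
have [w [xwx _ ww]] := sl2_pair xx xwx0.
by rewrite -xwx -mulrA -xC // mulrA xx mul0r.
Qed.

Lemma double_centralizer_U x (g : G) : x * x = 0 -> x != 0 ->
  (forall h, commute h (U x) -> commute h g) ->
  exists c d : F, io g = c *: 1 + d *: x.
Proof.
move=> xx x0 gC; apply: A_bicommutant => // y yy xy.
have /gC /commute_io : commute (U y) (U x).
  by apply/commute_U => //; rewrite ioU // mulrDl mulrDr mulr1 mul1r xy.
rewrite ioU // mulrDl mulrDr mulr1 mul1r => /addrI ->.
by [].
Qed.

(** * Images of square-zero unipotents under a group automorphism *)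

Section Automorphism.
Variables (f fi : G -> G).
Hypothesis (fM : {morph f : x y / (x * y)%g}).
Hypotheses (fK : cancel f fi) (fiK : cancel fi f).

Let f1 : f 1%g = 1%g.
Proof. by apply: (@mulgI _ (f 1%g)); rewrite -fM !mulg1. Qed.

Let fX (g : G) n : f (g ^+ n)%g = (f g ^+ n)%g.
Proof. by elim: n => [|n IHn]; rewrite ?expg0 ?f1 // !expgS fM IHn. Qed.

Let f_commute (g h : G) : commute (f g) (f h) <-> commute g h.
Proof. by rewrite /commute -!fM; split=> [/(can_inj fK)|->]. Qed.

Lemma image_power_unipotent x : x * x = 0 -> x != 0 ->
  exists N k, io (f (U x)) ^+ N - 1 != 0 /\ (io (f (U x)) ^+ N - 1) ^+ k = 0.
Proof.
move=> xx x0.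
have powN1 N : N%:R != 0 :> F -> io (f (U x)) ^+ N - 1 != 0.
  move=> N0; rewrite subr_eq0; apply: contra_neq N0 => /eqP.
  rewrite -ioX -fX -io1 -f1 => /eqP/io_inj/(can_inj fK).
  rewrite UX // => /(congr1 io); rewrite ioU ?square_zeroZ // io1.
  rewrite -[RHS]addr0 => /addrI/eqP; rewrite scaler_eq0 (negPf x0) orbF.
  by move/eqP.
have [[p pF]|char0] := pselect (exists p, p \in [pchar F]).
  have pA : p \in [pchar A] by rewrite pchar_lalg.
  exists 1%N, p; split; first by apply: powN1; rewrite oner_neq0.
  (* In characteristic [p], [(g - 1)^p = g^p - 1], and [g^p] is the image of [U (p x) = 1]. *)
  rewrite expr1 -(pFrobenius_autE pA) pFrobenius_autB_comm; last exact: commr1.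
  rewrite !pFrobenius_autE expr1n -ioX -fX UX //.
  by rewrite (pcharf0 pF) scale0r U0 f1 io1 subrr.
have [h hx] := U_conj_pow xx nz2.
have [|N [k [N0 Nk]]] := A_power_unipotent (g := f (U x)) (h := f h).
  by rewrite -ioX -!ioM -fX -!fM hx.
exists N, k; split=> //; apply: powN1.
have /pcharf0P -> : [pchar F] =i pred0; last by rewrite -lt0n.
by move=> p; apply/negP => pF; apply: char0; exists p.
Qed.

Lemma automorphism_square_zero x : x * x = 0 ->
  exists2 y, y * y = 0 & io (f (U x)) = 1 + y.
Proof.
move=> xx; have [->|x0] := eqVneq x 0.
  by exists 0; rewrite ?mul0r // U0 f1 io1 addr0.
have [N [k0 [y0]]] := image_power_unipotent xx x0.
set g := f (U x); set y := _ - 1 => yk0.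
(* With [k] the nilpotency index, [z = y^(k-1)] is nonzero, and [z^2 = 0] because
   [2 (k - 1) >= k]. *)
have [k yk k_min] := ex_minnP (ex_intro (fun k => y ^+ k == 0) k0 (introT eqP yk0)).
have k2 : (1 < k)%N.
  case: k yk {k_min} => [|[]] //; first by rewrite expr0 oner_eq0.
  by rewrite expr1 (negPf y0).
pose z := y ^+ k.-1.
have kk : (k <= k.-1 + k.-1)%N.
  by rewrite -{1}(prednK (ltnW k2)) -addn1 leq_add2l -ltnS prednK ?(ltnW k2).
have zz : z * z = 0 by rewrite -exprD -(subnKC kk) exprD (eqP yk) mul0r.
have z0 : z != 0.
  by apply: contraTneq k2 => /eqP/k_min; case: (k) => [|[|k1]] //=; rewrite ltnn.
have zC h : commute h g -> commute h (U z).
  move=> /commute_io hg; apply/(commute_U _ zz)/commrX/commrB; last exact: commr1.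
  exact: commrX.
(* The preimage of [1 + z] lies in the double centralizer of [1 + x], so it is [c + d x]. If [d]
   were zero, [z] would be central; hence [1 + z] and [g] have the same centralizer, and
   [g = c1 + d1 z]. *)
have zfC h : commute h (U x) -> commute h (fi (U z)).
  by move=> hx; apply/f_commute; rewrite fiK; apply/zC/f_commute.
have [c [d vE]] := double_centralizer_U xx x0 zfC.
have d0 : d != 0.
  apply: contra_neq z0 => d0; apply: square_zero_noncentral => // w ww.
  have : commute (U w) (U z).
    rewrite -[U w]fiK -[U z]fiK; apply/f_commute/commute_io.
    by rewrite vE d0 scale0r addr0 -scalerAl -scalerAr mul1r mulr1.
  by move/commute_U => /(_ zz); rewrite ioU // mulrDl mulrDr mul1r mulr1 => /addrI.
have gC h : commute h (U z) -> commute h g.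
  rewrite -{1}[h]fiK -{1}[U z]fiK => /f_commute/commute_io; rewrite vE.
  rewrite mulrDl mulrDr -!scalerAl -!scalerAr mul1r mulr1 => /addrI/(scalerI d0).
  by move=> hx; rewrite -[h]fiK; apply/f_commute/commute_U.
have [c1 [d1 gE]] := double_centralizer_U zz z0 gC.
have dzz := square_zeroZ d1 zz.
suff c11 : c1 = 1 by exists (d1 *: z); rewrite ?gE ?c11 ?scale1r.
(* Comparing [g] with its conjugate power [g^(k1^2)]: the difference of their scalar parts plus a
   multiple of [z] is a conjugate of the square-zero [d1 z], so the scalar parts agree. *)
have cX k1 : k1%:R != 0 :> F -> c1 ^+ (k1 ^ 2) = c1.
  move=> k10; have [h hx] := U_conj_pow xx k10.
  pose H := io (f h); pose H' := io ((f h)^-1)%g.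
  have [HH' H'H] : H * H' = 1 /\ H' * H = 1 := ioV (f h).
  have [e eE] := exprD_scalar_square_zero c1 (k1 ^ 2) dzz.
  have : H * io g = io g ^+ (k1 ^ 2) * H.
    by rewrite -ioX -!ioM -fX -!fM hx.
  move/(congr1 (fun a => a * H')); rewrite -[_ * H * H']mulrA HH' mulr1 gE eE.
  rewrite mulrDr mulrDl -scalerAr mulr1 -scalerAl HH' => cE.
  apply/eqP; rewrite -subr_eq0; apply/eqP.
  apply: (@scalar_add_square_zero F A _ (e *: (d1 *: z))); first by rewrite square_zeroZ.
  have -> : (c1 ^+ (k1 ^ 2) - c1) *: 1 + e *: (d1 *: z) = H * (d1 *: z) * H'.
    by rewrite scalerBl addrAC -cE addrAC subrr add0r.
  by rewrite -!mulrA (mulrA H') H'H mul1r (mulrA (d1 *: z)) dzz mul0r mulr0.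
have c10 : c1 != 0.
  apply: contraTneq isT => c0; have [gg' _] := ioV g.
  have : io g * io g = 0 by rewrite gE c0 scale0r add0r dzz.
  move/(congr1 (fun a => a * (io g^-1%g * io g^-1%g))).
  by rewrite mul0r mulrA -[X in X * _ = _]mulrA gg' mulr1 gg' => /eqP; rewrite oner_eq0.
(* [k1 = 2] gives [c1^4 = c1], so [c1^3 = 1]; [k1 = 3] gives [c1 = c1^9 = 1]. Both [2] and [3] must
   be nonzero in [F]. *)
have c3 : c1 ^+ 3 = 1 by apply: (mulfI c10); rewrite -exprS mulr1 -[RHS](cX 2).
by rewrite -(cX 3) // (exprM _ 3 3) c3 expr1n.
Qed.

Definition phi x : A := locked (io (f (U x)) - 1).

Lemma phiE x : io (f (U x)) = 1 + phi x.
Proof. by rewrite /phi -lock addrC subrK. Qed.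

Lemma phi_square_zero x : x * x = 0 -> phi x * phi x = 0.
Proof.
by move=> /automorphism_square_zero[y yy]; rewrite phiE => /addrI ->.
Qed.

Lemma fU x : x * x = 0 -> f (U x) = U (phi x).
Proof.
by move=> xx; apply: io_inj; rewrite phiE ioU //; apply: phi_square_zero.
Qed.

Lemma phi_inj x y : x * x = 0 -> y * y = 0 -> phi x = phi y -> x = y.
Proof.
move=> xx yy xy; have := phiE x; rewrite xy -phiE.
move=> /io_inj/(can_inj fK)/(congr1 io).
by rewrite !ioU // => /addrI.
Qed.

Lemma phi0 : phi 0 = 0.
Proof. by apply: (@addrI _ 1); rewrite -phiE U0 f1 io1 addr0. Qed.

Lemma phi_eq0 x : x * x = 0 -> phi x = 0 -> x = 0.
Proof. by move=> xx x0; apply: phi_inj; rewrite ?phi0 ?mul0r. Qed.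

Lemma phi_commute x y : x * x = 0 -> y * y = 0 -> x * y = y * x ->
  phi x * phi y = phi y * phi x.
Proof.
move=> xx yy xy; have : commute (U x) (U y).
  by apply/commute_U => //; rewrite ioU // mulrDl mulrDr mulr1 mul1r xy.
move/f_commute; rewrite (fU yy) => /(commute_U _ (phi_square_zero yy)).
by rewrite phiE mulrDl mulrDr mul1r mulr1 => /addrI.
Qed.

(** Write [X], [Y] for the images; they commute. As [1 + x + y] is a product, the image of [x + y]
    is [X + Y + XY]. Its square is [2 XY] and must vanish, so [XY = 0]. *)
Lemma phi_orthogonal_add x y : x * x = 0 -> y * y = 0 -> x * y = 0 -> y * x = 0 ->
  phi x * phi y = 0 /\ phi (x + y) = phi x + phi y.
Proof.
move=> xx yy xy yx.
have zz : (x + y) * (x + y) = 0 by rewrite mulrDl !mulrDr xx xy yx yy !addr0.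
have zE : phi (x + y) = phi x + phi y + phi x * phi y.
  apply: (@addrI _ 1); rewrite -phiE; have -> : U (x + y) = (U x * U y)%g.
    by apply: io_inj; rewrite ioM !ioU // mulrDr mulr1 mulrDl mul1r xy addr0 addrA.
  by rewrite fM ioM !phiE mulrDr mulr1 mulrDl mul1r !addrA.
have XY : phi x * phi y = phi y * phi x by apply: phi_commute; rewrite ?xy ?yx.
have XX := phi_square_zero xx; have YY := phi_square_zero yy.
have XY0 : phi x * phi y = 0.
  have Xz : phi x * phi (x + y) = phi x * phi y.
    by rewrite zE !mulrDr mulrA XX mul0r add0r addr0.
  have Yz : phi y * phi (x + y) = phi x * phi y.
    by rewrite zE !mulrDr mulrA -XY YY -mulrA YY mulr0 !addr0.
  have := phi_square_zero zz; rewrite {1}zE !mulrDl Xz Yz -mulrA Yz mulrA XX mul0r.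
  rewrite addr0 -mulr2n -scaler_nat => /eqP.
  by rewrite scaler_eq0 (negPf nz2) => /eqP.
by rewrite zE XY0 addr0.
Qed.

Lemma phi_orthogonal x y : x * x = 0 -> y * y = 0 -> x * y = 0 -> y * x = 0 ->
  phi x * phi y = 0.
Proof. by move=> xx yy xy yx; case: (phi_orthogonal_add xx yy xy yx). Qed.

Lemma phi_add x y : x * x = 0 -> y * y = 0 -> x * y = 0 -> y * x = 0 ->
  phi (x + y) = phi x + phi y.
Proof. by move=> xx yy xy yx; case: (phi_orthogonal_add xx yy xy yx). Qed.

(** As [y x = 0], [(1 + x)(1 + y) = (1 + xy)(1 + y)(1 + x)]. The image of [xy] annihilates those of
    [x] and [y] by orthogonality, so applying [f] leaves the bracket. *)
Lemma phi_bracket x y : x * x = 0 -> y * y = 0 -> y * x = 0 ->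
  phi (x * y) = phi x * phi y - phi y * phi x.
Proof.
move=> xx yy yx.
have zz : x * y * (x * y) = 0 by rewrite mulrA -(mulrA x) yx mulr0 mul0r.
have zx : phi (x * y) * phi x = 0.
  by apply: phi_orthogonal; rewrite // ?mulrA ?xx ?mul0r // -mulrA yx mulr0.
have zy : phi (x * y) * phi y = 0.
  by apply: phi_orthogonal; rewrite // ?mulrA ?yx ?mul0r // -mulrA yy mulr0.
have UxUy : (U x * U y)%g = (U (x * y) * (U y * U x))%g.
  apply: io_inj; rewrite !ioM !ioU //.
  have -> : (1 + y) * (1 + x) = 1 + x + y by rewrite mulrDl mul1r mulrDr mulr1 yx addr0.
  have xyE : x * y * (1 + x + y) = x * y.
    by rewrite !mulrDr mulr1 -!mulrA yx yy !mulr0 !addr0.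
  by rewrite [LHS]mulrDr mulr1 mulrDl mul1r [RHS]mulrDl mul1r xyE !addrA.
have := congr1 (fun g => io (f g)) UxUy; rewrite !fM !ioM !phiE.
rewrite [RHS]mulrDl mul1r [phi (x * y) * _]mulrA [phi (x * y) * _]mulrDr mulr1 zy addr0.
rewrite [phi (x * y) * _]mulrDr mulr1 zx addr0 ![_ * (1 + _)]mulrDr !mulr1 !mulrDl !mul1r.
rewrite -!addrA => /addrI; rewrite [RHS]addrCA => /addrI/addrI ->.
by rewrite addrC addrK.
Qed.

Lemma phiZ (a : F) x : x * x = 0 -> exists d, phi (a *: x) = d *: phi x.
Proof.
move=> xx; have [->|x0] := eqVneq x 0.
  by exists 0; rewrite scaler0 scale0r phi0.
have XX := phi_square_zero xx; have axx := square_zeroZ a xx.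
have X0 : phi x != 0 by apply: contra_neq x0; apply: phi_eq0.
(* Whatever commutes with [x] commutes with [a x], so the image of [1 + a x] is in the double
   centralizer of [1 + phi x]; its scalar part is then forced to be 1 by square-zeroness. *)
have [h|c [d]] := @double_centralizer_U (phi x) (f (U (a *: x))) XX X0.
  rewrite -{1}[h]fiK -(fU xx) => /f_commute/commute_U => /(_ xx) hx.
  rewrite -[h]fiK; apply/f_commute/commute_U => //.
  by rewrite -scalerAl -scalerAr hx.
rewrite phiE => /(canRL (addKr 1)); rewrite addrA -[- 1]scaleN1r -scalerDl => aX.
have c0 := scalar_add_square_zero (square_zeroZ d XX).
exists d; rewrite aX (c0 (- 1 + c)) ?scale0r ?add0r // -aX.
exact: phi_square_zero.
Qed.

(** * Matrix units *)

Section Frame.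
Variables (n : nat) (E : 'I_n -> 'I_n -> A).
Hypothesis frame : matrix_frame U E.

Let n_gt1 := frame_gt1 frame.
Let E_mul := frame_mul frame.
Let E_sum := frame_sum frame.
Let E_neq0 := frame_neq0 frame.
Let U_generates := frame_generates frame.

Local Notation block := (peirce_block E).

Lemma blockE i j c : block i j (E i i * c * E j j).
Proof. by rewrite /peirce_block !mulrA E_mul eqxx -mulrA E_mul eqxx. Qed.

Lemma block_unit i j : block i j (E i j).
Proof. by rewrite /peirce_block !E_mul !eqxx E_mul eqxx. Qed.

Lemma block_l i j k x : block i j x -> E k k * x = if k == i then x else 0.
Proof.
by move=> <-; rewrite !mulrA E_mul; case: eqP => [->|_]; rewrite ?mul0r.
Qed.

Lemma block_r i j k x : block i j x -> x * E k k = if j == k then x else 0.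
Proof.
by move=> <-; rewrite -mulrA E_mul; case: eqP => [->|_]; rewrite ?mulr0.
Qed.

Lemma block_mul0 i j k l x y : j != k -> block i j x -> block k l y -> x * y = 0.
Proof.
move=> /negPf jk bx by_; rewrite -[x]bx -mulrA (block_l _ by_) jk.
by rewrite mulr0.
Qed.

Lemma block_mul i j l x y : block i j x -> block j l y -> block i l (x * y).
Proof.
move=> bx by_; rewrite /peirce_block mulrA (block_l _ bx) eqxx -mulrA (block_r _ by_) eqxx.
by [].
Qed.

Lemma block_square_zero i j x : i != j -> block i j x -> x * x = 0.
Proof. by move=> ij bx; apply: (block_mul0 _ bx bx); rewrite eq_sym. Qed.

Lemma exists_neq (i : 'I_n) : exists j, i != j.
Proof.
have [/= i0|i0] := eqVneq (val i) 0%N.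
  by exists (Ordinal n_gt1); rewrite -val_eqE /= i0.
by exists (Ordinal (ltnW n_gt1)); rewrite -val_eqE.
Qed.

Lemma block_decomposition c : c = \sum_i \sum_j E i i * c * E j j.
Proof.
rewrite -[LHS]mulr1 -[c in LHS]mul1r -E_sum !mulr_suml; apply: eq_bigr => i _.
by rewrite mulr_sumr.
Qed.

Section BlockLemmas.
Variables (i j k l : 'I_n) (x y : A).

Lemma phi_block_mul0 : i != j -> k != l -> j != k -> i != l ->
  block i j x -> block k l y -> phi x * phi y = 0.
Proof.
move=> ij kl jk il bx by_; apply: phi_orthogonal.
- exact: block_square_zero bx.
- exact: block_square_zero by_.
- exact: block_mul0 bx by_.
- by apply: block_mul0 by_ bx; rewrite eq_sym.
Qed.

Lemma phi_block_add : i != j -> block i j x -> block i j y ->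
  phi (x + y) = phi x + phi y.
Proof.
move=> ij bx by_; apply: phi_add.
- exact: block_square_zero bx.
- exact: block_square_zero by_.
- by apply: block_mul0 bx by_; rewrite eq_sym.
- by apply: block_mul0 by_ bx; rewrite eq_sym.
Qed.

Lemma phi_block_bracket : i != j -> j != k -> i != k -> block i j x -> block j k y ->
  phi (x * y) = phi x * phi y - phi y * phi x.
Proof.
move=> ij jk ik bx by_; apply: phi_bracket.
- exact: block_square_zero bx.
- exact: block_square_zero by_.
- by apply: block_mul0 by_ bx; rewrite eq_sym.
Qed.

End BlockLemmas.

(** An induction principle: the images of the off-diagonal blocks generate the ring. Surjectivity of
    [f] puts every off-diagonal block in [S], and a diagonal block is a product of two off-diagonal
    ones. *)
Lemma phi_generates (S : A -> Prop) : S 1 ->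
  (forall x y, S x -> S y -> S (x + y)) -> (forall x, S x -> S (- x)) ->
  (forall x y, S x -> S y -> S (x * y)) ->
  (forall i j x, i != j -> block i j x -> S (phi x)) -> forall x, S x.
Proof.
move=> S1 SD SN SM Sphi.
have Sf : forall g, S (io (f g)).
  apply: U_generates => [|g h Sg Sh|i j x ij bx]; first by rewrite f1 io1.
    by rewrite fM ioM; apply: SM.
  by rewrite phiE; apply: SD => //; apply: Sphi bx.
have Sb i j x : i != j -> block i j x -> S x.
  move=> ij bx; have /= := Sf (fi (U x)); rewrite fiK ioU; last first.
    exact: block_square_zero bx.
  by move/(SD _ _ (SN _ S1)); rewrite addKr.
have S0 : S 0 by have := SD _ _ S1 (SN _ S1); rewrite subrr.
move=> x; rewrite [x]block_decomposition.
elim/big_ind: _ => // i _; elim/big_ind: _ => // j _.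
have [<-|ij] := eqVneq i j; last by apply: Sb ij _; apply: blockE.
have [k ik] := exists_neq i.
have -> : E i i * x * E i i = (E i i * (x * E i k) * E k k) * E k i.
  by rewrite -!mulrA !E_mul !eqxx E_mul eqxx.
apply: SM; first by apply: Sb ik _; apply: blockE.
by apply: Sb (block_unit k i); rewrite eq_sym.
Qed.

(** In the bracket formula for [phi (x y)], the term [phi y phi x] vanishes for a map induced by a
    ring automorphism; for the contragredient, where [phi x = - x^t], it is the other term that
    vanishes. *)
Definition no_dual_part := forall i j k x y, i != j -> j != k -> i != k ->
  block i j x -> block j k y -> phi y * phi x = 0.

Definition no_natural_part := forall i j k x y, i != j -> j != k -> i != k ->
  block i j x -> block j k y -> phi x * phi y = 0.

(** Multiply the bracket formula for [phi (c y)] on the left by [phi x]: all terms but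
    [phi x phi y phi c] vanish by orthogonality of blocks. *)
Lemma natural_product_mul0 i j k l x y c :
  i != j -> j != k -> i != k -> l != j -> l != k ->
  block i j x -> block j k y -> block l j c -> phi x * phi y * phi c = 0.
Proof.
move=> ij jk ik lj lk bx by_ bc.
have := phi_block_bracket lj jk lk bc by_.
move=> /(congr1 (fun z => phi x * z)); rewrite mulrBr !mulrA.
rewrite (phi_block_mul0 (j := j) (k := l) _ _ _ _ bx bc) // 1?eq_sym //.
rewrite (phi_block_mul0 (j := j) (k := l) _ _ _ _ bx (block_mul bc by_)) // 1?eq_sym //.
by rewrite mul0r sub0r => /esym/eqP; rewrite oppr_eq0 => /eqP.
Qed.

Definition natural_annihilator (z : A) := forall i j k x y,
  i != j -> j != k -> i != k -> block i j x -> block j k y -> phi x * phi y * z = 0.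

(** This is the generator step in proving that the annihilator is a left ideal. The cases record
    whether the block of [c] continues that of [y] or ends where that of [x] does; when both hold,
    the bracket moves the product to [phi (x y)]. *)
Lemma natural_annihilator_phi l m c z : l != m -> block l m c ->
  natural_annihilator z -> natural_annihilator (phi c * z).
Proof.
move=> lm bc Wz i j k x y ij jk ik bx by_; rewrite mulrA.
have [kl|kl] := eqVneq k l; have [mj|mj] := eqVneq m j.
- subst l m; have -> : phi x * phi y = phi (x * y) + phi y * phi x.
    by rewrite (phi_block_bracket ij jk ik bx by_) subrK.
  rewrite !mulrDl (Wz i k j) // 1?eq_sym //; last exact: block_mul by_.
  by rewrite add0r -(mulrA (phi y)) (phi_block_mul0 ij lm jk ij bx bc) mulr0 mul0r.
- subst l; rewrite -!mulrA (mulrA (phi y)) (Wz j k m) ?mulr0 // eq_sym.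
  by [].
- subst m; rewrite (natural_product_mul0 ij jk ik lm _ bx by_ bc) ?mul0r //.
  by rewrite eq_sym.
- rewrite -(mulrA (phi x)) (phi_block_mul0 jk lm kl _ by_ bc) ?mulr0 ?mul0r //.
  by rewrite eq_sym.
Qed.

Lemma dual_product_annihilates l m r u v : l != m -> m != r -> l != r ->
  block l m u -> block m r v -> natural_annihilator (phi v * phi u).
Proof.
move=> lm mr lr bu bv i j k x y ij jk ik bx by_; rewrite mulrA.
have [km|km] := eqVneq k m; have [rj|rj] := eqVneq r j.
- subst m r; have -> : phi x * phi y = phi (x * y) + phi y * phi x.
    by rewrite (phi_block_bracket ij jk ik bx by_) subrK.
  rewrite mulrDl -(mulrA (phi y)) (phi_block_mul0 ij mr jk ij bx bv) mulr0 addr0.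
  exact: (natural_product_mul0 ik mr ij lm lr (block_mul bx by_) bv bu).
- subst m; rewrite -!mulrA (mulrA (phi y)).
  by rewrite (natural_product_mul0 jk mr _ lm lr by_ bv bu) ?mulr0 // eq_sym.
- subst r; rewrite (natural_product_mul0 ij jk ik mr _ bx by_ bv) ?mul0r //.
  by rewrite eq_sym.
- rewrite -(mulrA (phi x)) (phi_block_mul0 jk mr km _ by_ bv) ?mulr0 ?mul0r //.
  by rewrite eq_sym.
Qed.

Lemma natural_annihilator_ideal d z :
  natural_annihilator z -> natural_annihilator (d * z).
Proof.
move: z; elim/phi_generates: d => [z|d d' Wd Wd' z Wz|d Wd z Wz|d d' Wd Wd' z Wz|].
- by rewrite mul1r.
- move=> i j k x y *; rewrite mulrDl mulrDr (Wd _ Wz i j k) // (Wd' _ Wz i j k) //.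
  by rewrite addr0.
- by move=> i j k x y *; rewrite mulNr mulrN (Wd _ Wz i j k) // oppr0.
- by rewrite -mulrA; apply/Wd/Wd'.
- by move=> i j x ij bx z; apply: natural_annihilator_phi ij bx.
Qed.

(** Natural products, multiplied by any [d] and then by a dual product, give zero; a prime ring
    leaves only one nonzero family. *)
Lemma no_dual_or_no_natural_part : no_dual_part \/ no_natural_part.
Proof.
have [|nd] := pselect no_dual_part; [by left|right].
move=> i j k x y ij jk ik bx by_; apply: contrapT => xy0; apply: nd.
move=> l m r u v lm mr lr bu bv.
have [d||//] := A_prime (a := phi x * phi y) (b := phi v * phi u); last by move/xy0.
rewrite -mulrA.
by apply: (natural_annihilator_ideal d (dual_product_annihilates lm mr lr bu bv)) bx by_.
Qed.

(** * Assembling a ring automorphism from its Peirce components *)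

Section Extension.
Variable theta : 'I_n -> 'I_n -> A -> A.
Hypothesis thetaD : forall i j a b, theta i j (a + b) = theta i j a + theta i j b.
Hypothesis theta_block : forall i j a, theta i j (E i i * a * E j j) = theta i j a.
Hypothesis thetaM : forall i j k a b,
  theta i j a * theta j k b = theta i k (a * E j j * b).
Hypothesis theta_mul0 : forall i j k l a b, j != k -> theta i j a * theta k l b = 0.
Hypothesis theta_phi : forall i j x, i != j -> block i j x -> theta i j x = phi x.

Let Phi c := \sum_i \sum_j theta i j c.

Let theta0 i j : theta i j 0 = 0.
Proof. by apply: (@addrI _ (theta i j 0)); rewrite -thetaD !addr0. Qed.

Let theta_sum i j (I : finType) (c : I -> A) :
  theta i j (\sum_k c k) = \sum_k theta i j (c k).
Proof. by apply: big_morph; [exact: thetaD|exact: theta0]. Qed.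

Let PhiD a b : Phi (a + b) = Phi a + Phi b.
Proof.
rewrite -big_split; apply: eq_bigr => i _; rewrite -big_split.
by apply: eq_bigr => j _; apply: thetaD.
Qed.

Let PhiM a b : Phi (a * b) = Phi a * Phi b.
Proof.
rewrite /Phi mulr_suml; apply: eq_bigr => i _.
rewrite -[a in LHS]mulr1 -E_sum mulr_sumr mulr_suml.
under eq_bigr do rewrite theta_sum.
rewrite exchange_big mulr_suml; apply: eq_bigr => j _.
rewrite mulr_sumr [RHS](bigD1 j) //= [X in _ = _ + X]big1 => [|k kj]; last first.
  by rewrite mulr_sumr big1 // => l _; apply: theta_mul0; rewrite eq_sym.
by rewrite addr0 mulr_sumr; apply: eq_bigr => l _; rewrite thetaM.
Qed.

Let Phi_phi i j x : i != j -> block i j x -> Phi x = phi x.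
Proof.
move=> ij bx; rewrite /Phi (bigD1 i) //= [X in _ + X]big1 => [|k ki]; last first.
  apply: big1 => l _; rewrite -theta_block (block_l _ bx) (negPf ki).
  by rewrite mul0r theta0.
rewrite addr0 (bigD1 j) //= [X in _ + X]big1 => [|l lj]; last first.
  by rewrite -theta_block -mulrA (block_r _ bx) eq_sym (negPf lj) mulr0 theta0.
by rewrite addr0 theta_phi.
Qed.

Let Phi0 : Phi 0 = 0.
Proof. by apply: (@addrI _ (Phi 0)); rewrite -PhiD !addr0. Qed.

Let PhiN a : Phi (- a) = - Phi a.
Proof. by apply: (@addrI _ (Phi a)); rewrite -PhiD !subrr Phi0. Qed.

Let i0 := Ordinal (ltnW n_gt1).
Let j0 := Ordinal n_gt1.
Let ij0 : i0 != j0. Proof. by []. Qed.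

Let phi_E_neq0 i j : i != j -> phi (E i j) != 0.
Proof.
move=> ij; apply: contra_neq (E_neq0 i j); apply: phi_eq0.
by apply: block_square_zero ij _; apply: block_unit.
Qed.

(* [Phi 1] is a nonzero central idempotent. *)
Let Phi1 : Phi 1 = 1.
Proof.
have eC d : Phi 1 * d = d * Phi 1.
  elim/phi_generates: d => [|d d' dC dC'|d dC|d d' dC dC'|i j x ij bx].
  - by rewrite mulr1 mul1r.
  - by rewrite mulrDr mulrDl dC dC'.
  - by rewrite mulrN mulNr dC.
  - by rewrite mulrA dC -mulrA dC' mulrA.
  - by rewrite -(Phi_phi ij bx) -!PhiM mulr1 mul1r.
have [d|e0|/eqP] := A_prime (a := Phi 1) (b := 1 - Phi 1).
- by rewrite eC -mulrA mulrBr mulr1 -PhiM mulr1 subrr mulr0.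
- have := phi_E_neq0 ij0; rewrite -(Phi_phi ij0 (block_unit _ _)).
  by rewrite -[E _ _]mul1r PhiM e0 mul0r eqxx.
- by rewrite subr_eq0 => /eqP.
Qed.

(** Matrix units move any Peirce component of a kernel element into the off-diagonal block [i0, j0],
    where [Phi] is [phi] and has no kernel. *)
Let Phi_inj : injective Phi.
Proof.
move=> a b /eqP; rewrite -subr_eq0 -PhiN -PhiD => /eqP ab0.
apply/eqP; rewrite -subr_eq0; move: (a - b) ab0 => c c0.
rewrite [c]block_decomposition big1 // => i _; apply: big1 => j _.
have bz : block i0 j0 (E i0 i * c * E j j0).
  by rewrite /peirce_block !mulrA E_mul eqxx -mulrA E_mul eqxx.
have z0 : E i0 i * c * E j j0 = 0.
  apply: phi_eq0; first exact: block_square_zero bz.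
  by rewrite -(Phi_phi ij0 bz) !PhiM c0 mulr0 mul0r.
transitivity (E i i0 * (E i0 i * c * E j j0) * E j0 j).
  by rewrite !mulrA E_mul eqxx -[RHS]mulrA E_mul eqxx.
by rewrite z0 mulr0 mul0r.
Qed.

(** [Phi] is onto because its image is a subring containing the generators of [phi_generates];
    agreement with [f] is checked on generating unipotents. *)
Lemma automorphism_extension : extends_to_ring_automorphism io f.
Proof.
exists Phi; split=> //.
  have surj d : exists c, Phi c = d.
    elim/phi_generates: d => [|_ _ [c <-] [c' <-]|_ [c <-]|_ _ [c <-] [c' <-]|i j x ij bx].
    - by exists 1.
    - by exists (c + c').
    - by exists (- c).
    - by exists (c * c').
    - by exists x; apply: Phi_phi bx.
  have [Psi PsiK] := choice surj.
  by exists Psi => // c; apply: Phi_inj; rewrite PsiK.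
apply: U_generates => [|g h eg eh|i j x ij bx]; first by rewrite f1 io1 Phi1.
  by rewrite fM !ioM PhiM eg eh.
rewrite phiE ioU; last exact: block_square_zero bx.
by rewrite PhiD Phi1 (Phi_phi ij bx).
Qed.

End Extension.

(** * Extension when there are at least three indices *)

Section RankAtLeast3.
Hypothesis n_gt2 : (2 < n)%N.
Hypothesis no_dual : no_dual_part.

Lemma exists_neq2 (i j : 'I_n) : exists k, i != k /\ j != k.
Proof.
apply: contrapT => /forallNP H.
have : (#|'I_n| <= #|pred2 i j|)%N.
  apply: subset_leq_card; apply/fintype.subsetP => k _; rewrite !inE; apply: contraT.
  by rewrite negb_or => /andP[ki kj]; case: (H k); rewrite ![_ == k]eq_sym.
by rewrite card_ord card2 leqNgt (leq_trans _ n_gt2) // !ltnS leq_b1.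
Qed.

Lemma phiM i j k x y : i != j -> j != k -> i != k ->
  block i j x -> block j k y -> phi x * phi y = phi (x * y).
Proof.
move=> ij jk ik bx by_; rewrite (phi_block_bracket ij jk ik bx by_).
by rewrite (no_dual ij jk ik bx by_) subr0.
Qed.

Lemma phi_mul0 i j k l x y : i != j -> k != l -> j != k ->
  block i j x -> block k l y -> phi x * phi y = 0.
Proof.
move=> ij kl jk bx by_; have [il|il] := eqVneq i l; last first.
  exact: phi_block_mul0 ij kl jk il bx by_.
by subst l; apply: no_dual by_ bx; rewrite // eq_sym.
Qed.

Let block_E i j k x : block i j x -> block i k (x * E j k).
Proof. by move=> bx; apply: block_mul bx (block_unit j k). Qed.

Let mulEK i j k x : block i j x -> x * E j k * E k j = x.
Proof. by move=> bx; rewrite -mulrA E_mul eqxx (block_r _ bx) eqxx. Qed.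

(** A diagonal block element [a] is given the image [phi (a E_it) phi (E_ti)]. The lemma shows that
    this depends neither on [t] nor on the factorization [a = x y]; when [t = j], both sides are
    compared through a third index. *)
Lemma phi_loop i j t x y : i != j -> i != t -> block i j x -> block j i y ->
  phi x * phi y = phi (x * y * E i t) * phi (E t i).
Proof.
have loop s x' y' : i != j -> i != s -> j != s -> block i j x' -> block j i y' ->
    phi x' * phi y' = phi (x' * y' * E i s) * phi (E s i).
  move=> ij is_ js bx by_; have bys := block_E s by_.
  rewrite -[in LHS](mulEK s by_) -(phiM js _ _ bys (block_unit s i)) 1?eq_sym //.
  by rewrite mulrA (phiM ij js is_ bx bys) mulrA.
move=> ij it bx by_; have [jt|jt] := eqVneq j t; last exact: loop.
subst t; have [s [is_ js]] := exists_neq2 i j.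
rewrite (loop s) // (loop s _ (E j i)) //; last exact: block_unit.
  by rewrite (mulEK j (block_mul bx by_)).
exact: block_E (block_mul bx by_).
Qed.

(** The detour index is changed to some [s] different from [j], after which only products of
    consecutive blocks with distinct indices occur. *)
Lemma phi_loop_l i j t a y : i != j -> i != t -> block i i a -> block i j y ->
  phi (a * E i t) * phi (E t i) * phi y = phi (a * y).
Proof.
move=> ij it ba by_; have [s [is_ js]] := exists_neq2 i j.
rewrite (phi_loop it is_ (block_E t ba) (block_unit t i)) (mulEK t ba).
have bsy : block s j (E s i * y) := block_mul (block_unit s i) by_.
rewrite -mulrA (phiM _ ij _ (block_unit s i) by_) 1?eq_sym //.
rewrite (phiM is_ _ ij (block_E s ba) bsy) 1?eq_sym //.
by rewrite mulrA (mulEK s ba).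
Qed.

Lemma phi_loop_r i j t a y : i != j -> i != t -> block i i a -> block j i y ->
  phi y * (phi (a * E i t) * phi (E t i)) = phi (y * a).
Proof.
move=> ij it ba by_; have [s [is_ js]] := exists_neq2 i j.
rewrite (phi_loop it is_ (block_E t ba) (block_unit t i)) (mulEK t ba) mulrA.
rewrite (phiM _ is_ js by_ (block_E s ba)) 1?eq_sym //.
rewrite (phiM js _ _ _ (block_unit s i)) 1?eq_sym // mulrA.
  by rewrite (mulEK s (block_mul by_ ba)).
exact: block_E (block_mul by_ ba).
Qed.

Lemma extension_rank3 : extends_to_ring_automorphism io f.
Proof.
(* [t i] is an arbitrary detour index, used to define the diagonal components. *)
have [t it] := choice exists_neq.
pose theta i j c := if i == j
  then phi (E i i * c * E i i * E i (t i)) * phi (E (t i) i)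
  else phi (E i i * c * E j j).
apply: (@automorphism_extension theta).
- move=> i j a b; rewrite /theta; case: eqVneq => [_|ij].
    rewrite -mulrDl -(phi_block_add (it i) (block_E _ _) (block_E _ _)) ?mulrDr ?mulrDl //;
    exact: blockE.
  by rewrite mulrDr mulrDl; apply: phi_block_add ij _ _; apply: blockE.
- move=> i j a; rewrite /theta; case: eqVneq => [<-|_].
    by rewrite !mulrA !E_mul eqxx -[_ * E i i * E i i]mulrA E_mul eqxx.
  by rewrite !mulrA !E_mul eqxx -[_ * E j j * E j j]mulrA E_mul eqxx.
- move=> i j k a b; rewrite /theta.
  have ab : E i i * (a * E j j * b) * E k k = E i i * a * E j j * (E j j * b * E k k).
    by rewrite !mulrA -[_ * E j j * E j j]mulrA E_mul eqxx.
  case: (eqVneq i j) => [ij|ij]; case: (eqVneq j k) => [jk|jk].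
  + subst j k; rewrite eqxx ab mulrA (phi_loop_l (it i)) ?mulrA //; first exact: blockE.
    exact: block_E (blockE _ _ _).
  + by subst j; rewrite (negPf jk) ab (phi_loop_l jk (it i)) //; apply: blockE.
  + subst k; have ji : j != i by rewrite eq_sym.
    by rewrite (negPf ij) ab (phi_loop_r ji (it j)) //; apply: blockE.
  + case: (eqVneq i k) => [ik|ik].
      by subst k; rewrite ab (phi_loop ij (it i)) //; apply: blockE.
    by rewrite ab (phiM ij jk ik) //; apply: blockE.
- move=> i j k l a b jk; rewrite /theta.
  have ti i' : t i' != i' by rewrite eq_sym.
  have bt i' c : block i' (t i') (E i' i' * c * E i' i' * E i' (t i')).
    exact: block_E (blockE _ _ _).
  case: (eqVneq i j) => [ij|ij]; case: (eqVneq k l) => [kl|kl].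
  + subst j; rewrite -mulrA (mulrA (phi (E _ _))).
    by rewrite (phi_mul0 (ti i) (it k) jk (block_unit _ _) (bt _ _)) mul0r mulr0.
  + subst j; rewrite -mulrA.
    by rewrite (phi_mul0 (ti i) kl jk (block_unit _ _) (blockE _ _ _)) mulr0.
  + by rewrite mulrA (phi_mul0 ij (it k) jk (blockE _ _ _) (bt _ _)) mul0r.
  + exact: phi_mul0 ij kl jk (blockE _ _ _) (blockE _ _ _).
- by move=> i j x ij bx; rewrite /theta (negPf ij) bx.
Qed.

End RankAtLeast3.

(** * Extension when there are two indices and one-dimensional blocks *)

Section Rank2.
Hypothesis n_eq2 : forall i j k : 'I_n, i != j -> i != k -> j = k.
Hypothesis corner : forall i j c, exists k : F, E i i * c * E j j = k *: E i j.

Let EE i j : i != j -> E i j * E i j = 0.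
Proof. by move=> ij; rewrite E_mul eq_sym (negPf ij). Qed.

Let phiE_neq0 i j : i != j -> phi (E i j) != 0.
Proof.
by move=> ij; apply: contra_neq (E_neq0 i j); apply: phi_eq0; apply: EE.
Qed.

Lemma scalar_map : exists tau : 'I_n -> 'I_n -> F -> F,
  forall i j a, i != j -> phi (a *: E i j) = tau i j a *: phi (E i j).
Proof.
have /choice[tau tauE] (t : 'I_n * 'I_n * F) : exists d, t.1.1 != t.1.2 ->
    phi (t.2 *: E t.1.1 t.1.2) = d *: phi (E t.1.1 t.1.2).
  have [e|ij] := eqVneq t.1.1 t.1.2; first by exists 0.
  by have [d dE] := phiZ t.2 (EE ij); exists d.
by exists (fun i j a => tau (i, j, a)) => i j a; exact: (tauE (i, j, a)).
Qed.

Section ScalarMap.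
Variable tau : 'I_n -> 'I_n -> F -> F.
Hypothesis tauE : forall i j a, i != j -> phi (a *: E i j) = tau i j a *: phi (E i j).

Let tau_uniq i j a b : i != j -> a *: phi (E i j) = b *: phi (E i j) -> a = b.
Proof.
move=> ij /eqP; rewrite -subr_eq0 -scalerBl scaler_eq0 (negPf (phiE_neq0 ij)) orbF.
by rewrite subr_eq0 => /eqP.
Qed.

Let blockZ i j a : block i j (a *: E i j).
Proof. by rewrite /peirce_block -scalerAr -scalerAl (block_unit i j). Qed.

Let tau1 i j : i != j -> tau i j 1 = 1.
Proof. by move=> ij; apply: (tau_uniq ij); rewrite -tauE // !scale1r. Qed.

Let tauD i j a b : i != j -> tau i j (a + b) = tau i j a + tau i j b.
Proof.
move=> ij; apply: (tau_uniq ij); rewrite -tauE // !scalerDl -!tauE //.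
exact: phi_block_add ij (blockZ _ _ _) (blockZ _ _ _).
Qed.

Let tau0 i j : i != j -> tau i j 0 = 0.
Proof.
by move=> ij; apply: (@addrI _ (tau i j 0)); rewrite -tauD // !addr0.
Qed.

Let tauN i j a : i != j -> tau i j (- a) = - tau i j a.
Proof.
by move=> ij; apply: (@addrI _ (tau i j a)); rewrite -tauD // !subrr tau0.
Qed.

(** Some [h] scales every [d E_ij] by [k^2] under conjugation, so [f h] scales the whole line of
    [phi (E_ij)] by one factor; it is read off at [d = 1] and compared at [d = c]. *)
Let tau_sqM i j k c : i != j -> tau i j (k ^+ 2 * c) = tau i j (k ^+ 2) * tau i j c.
Proof.
move=> ij; have [->|k0] := eqVneq k 0; first by rewrite expr0n mul0r tau0 // mul0r.
have [h hx] := square_zero_conj_scale (EE ij) k0.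
have hc d : io (f h) * phi (d *: E i j) = phi ((k ^+ 2 * d) *: E i j) * io (f h).
  have xx e : e *: E i j * (e *: E i j) = 0 by apply: square_zeroZ; apply: EE.
  have hU : (h * U (d *: E i j) = U ((k ^+ 2 * d) *: E i j) * h)%g.
    apply: io_inj; rewrite !ioM !ioU // mulrDr mulrDl mulr1 mul1r -scalerAr hx.
    by rewrite !scalerA -scalerAl mulrC.
  have := congr1 (fun g => io (f g)) hU; rewrite !fM !ioM !phiE.
  by rewrite mulrDr mulrDl mulr1 mul1r => /addrI.
have h1 := hc 1; rewrite mulr1 scale1r in h1.
have := hc c; rewrite !tauE // -scalerAr h1 tauE // -!scalerAl scalerA.
have [H'H HH'] := ioV (f h).
move/(congr1 (fun z => z * io ((f h)^-1)%g)); rewrite -!scalerAl -!mulrA H'H mulr1.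
by rewrite mulrC => /(tau_uniq ij).
Qed.

Let tauM i j a b : i != j -> tau i j (a * b) = tau i j a * tau i j b.
Proof.
(* Multiplicativity for squares suffices, since [a = ((a+1)/2)^2 - ((a-1)/2)^2]. *)
move=> ij; have [u [v ->]] : exists u v, a = u ^+ 2 - v ^+ 2.
  exists ((a + 1) / 2%:R), ((a - 1) / 2%:R); rewrite subr_sqr -mulrBl -mulrDl.
  rewrite [a + 1 - _]addrC opprB addrA subrK addrACA subrr addr0 -!mulr2n.
  by rewrite mulfV // mul1r -[a *+ 2]mulr_natr mulfK.
by rewrite mulrBl !tauD // !tauN // !tau_sqM // mulrBl.
Qed.

(* [1 + a E i j] and [1 - a^-1 E j i] satisfy the braid relation of [SL_2]; the
   common value [z] is annihilated by all the [phi (c *: E i j)], so it is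
   central. *)
Let tau_braid i j a : i != j -> a != 0 ->
  tau i j a *: phi (E i j) +
  (tau i j a ^+ 2 * tau j i (- a^-1)) *: (phi (E i j) * phi (E j i) * phi (E i j)) = 0.
Proof.
move=> ij a0; have ji : j != i by rewrite eq_sym.
pose x := a *: E i j; pose y := - a^-1 *: E j i.
have xx : x * x = 0 by apply: square_zeroZ; apply: EE.
have yy : y * y = 0 by apply: square_zeroZ; apply: EE.
have xyx : x * y * x = - x.
  rewrite /x /y -!(scalerAl, scalerAr) E_mul eqxx E_mul eqxx !scalerA -scaleNr.
  by rewrite mulrN mulfV // mulrN1.
have yxy : y * x * y = - y.
  rewrite /x /y -!(scalerAl, scalerAr) E_mul eqxx E_mul eqxx !scalerA -scaleNr.
  by rewrite [- a^-1 * a]mulNr mulVf // mulrN1.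
pose X := phi x; pose Y := phi y.
have XX : X * X = 0 by apply: phi_square_zero.
have YY : Y * Y = 0 by apply: phi_square_zero.
have braid (p q : A) : p * p = 0 ->
    (1 + p) * (1 + q) * (1 + p) = 1 + p + q + p * q + q * p + (p + p * q * p).
  move=> pp.
  have -> : (1 + p) * (1 + q) = 1 + p + q + p * q.
    by rewrite mulrDr mulr1 mulrDl mul1r addrA.
  have -> : 1 + p + q + p * q + q * p + (p + p * q * p) =
      1 + p + q + p * q + (1 + p + q + p * q) * p.
    by rewrite !mulrDl mul1r pp addr0 [p + q * p]addrC !addrA.
  by rewrite mulrDr mulr1.
have UU : (U x * U y * U x = U y * U x * U y)%g.
  apply: io_inj; rewrite !ioM !ioU // !braid // xyx yxy !subrr !addr0.
  by rewrite [LHS](ACl (1*3*2*5*4)%AC).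
have zE : X + X * Y * X = Y + Y * X * Y.
  have := congr1 (fun g => io (f g)) UU; rewrite !fM !ioM !phiE !braid //.
  by rewrite [1 + Y + X + _ + _](ACl (1*3*2*5*4)%AC) => /addrI.
pose z := X + X * Y * X.
have Xz : X * z = 0 by rewrite mulrDr !mulrA XX !mul0r addr0.
have zX : z * X = 0 by rewrite mulrDl -!mulrA XX !mulr0 addr0.
have Yz : Y * z = 0 by rewrite /z zE mulrDr !mulrA YY !mul0r addr0.
have zY : z * Y = 0 by rewrite /z zE mulrDl -!mulrA YY !mulr0 addr0.
have zz : z * z = 0 by rewrite {1}/z mulrDl Xz -!mulrA Xz !mulr0 addr0.
have tau_neq0 k l b : k != l -> b != 0 -> tau k l b != 0.
  move=> kl; apply: contra_neq => tb0; apply/eqP.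
  have /eqP : b *: E k l = 0.
    by apply: phi_eq0; [apply: square_zeroZ; apply: EE|rewrite tauE // tb0 scale0r].
  by rewrite scaler_eq0 (negPf (E_neq0 k l)) orbF.
have z0 : z = 0.
  have ann k l w : k != l -> block k l w -> z * phi w = 0 /\ phi w * z = 0.
    move=> kl bw; have [b wE] := corner k l w; rewrite bw in wE.
    have ta0 : tau i j a != 0 by apply: tau_neq0.
    have tb0 : tau j i (- a^-1) != 0 by apply: tau_neq0; rewrite // oppr_eq0 invr_eq0.
    have [p [q [Ez zE' Epq]]] : exists p q, [/\ z * p = 0, p * z = 0 & phi (E k l) = q *: p].
      have [ki|ki] := eqVneq k i.
        subst k; have lj : l = j by apply: n_eq2 kl ij.
        subst l; exists X, (tau i j a)^-1; split=> //.
        by rewrite /X /x tauE // scalerA mulVf // scale1r.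
      have kj : k = j by apply: (n_eq2 (i := i)); rewrite // eq_sym.
      subst k; have li : l = i by apply: n_eq2 kl ji.
      subst l; exists Y, (tau j i (- a^-1))^-1; split=> //.
      by rewrite /Y /y tauE // scalerA mulVf // scale1r.
    rewrite wE tauE // Epq -!(scalerAl, scalerAr) Ez zE' !scaler0.
    by split.
  apply: square_zero_noncentral => // d _.
  elim/phi_generates: d => [|d d' dC dC'|d dC|d d' dC dC'|k l w kl bw].
  - by rewrite mulr1 mul1r.
  - by rewrite mulrDr [(d + d') * _]mulrDl dC dC'.
  - by rewrite mulrN mulNr dC.
  - by rewrite mulrA dC -mulrA dC' mulrA.
  - by have [-> ->] := ann k l w kl bw.
rewrite -{}[RHS]z0 /z /X /Y /x /y !tauE //.
rewrite -!(scalerAl, scalerAr) !scalerA; congr (_ + _ *: _).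
by rewrite expr2 mulrA.
Qed.

Let phi_sandwich i j : i != j -> phi (E i j) * phi (E j i) * phi (E i j) = phi (E i j).
Proof.
move=> ij; have ji : j != i by rewrite eq_sym.
have := tau_braid ij (oner_neq0 F); rewrite invr1 tau1 // tauN // tau1 //.
rewrite expr1n mul1r scale1r scaleN1r => /eqP; rewrite subr_eq0 => /eqP.
by move/esym.
Qed.

Let tauV i j a : i != j -> a != 0 -> tau i j a * tau j i a^-1 = 1.
Proof.
move=> ij a0; have ji : j != i by rewrite eq_sym.
have := tau_braid ij a0; rewrite phi_sandwich // -scalerDl => /eqP.
rewrite scaler_eq0 (negPf (phiE_neq0 ij)) orbF tauN // mulrN expr2 -mulrA.
rewrite -{1}[tau i j a]mulr1 -mulrBr mulf_eq0 subr_eq0 => /orP[/eqP ta0|/eqP <- //].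
have : tau i j (a / a) = 1 by rewrite mulfV // tau1.
rewrite tauM // ta0 mul0r => /eqP.
by rewrite eq_sym oner_eq0.
Qed.

(** Both sides are inverse to [tau i j a^-1]: one by the braid relation, the other by
    multiplicativity. Hence one field map [t] serves all blocks. *)
Let tau_sym i j a : i != j -> tau j i a = tau i j a.
Proof.
move=> ij; have ji : j != i by rewrite eq_sym.
have [->|a0] := eqVneq a 0; first by rewrite !tau0.
have aa : tau i j a^-1 * tau j i a = 1.
  by rewrite -{2}[a]invrK; apply: tauV; rewrite // invr_eq0.
have ta : tau i j a * tau i j a^-1 = 1 by rewrite -tauM // mulfV // tau1.
by rewrite -[LHS]mul1r -ta -mulrA aa mulr1.
Qed.

Lemma extension_of_scalar_map : extends_to_ring_automorphism io f.
Proof.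
have [o oE] := choice exists_neq.
have /choice[kap kapE] (t : 'I_n * 'I_n * A) : exists k : F,
    E t.1.1 t.1.1 * t.2 * E t.1.2 t.1.2 = k *: E t.1.1 t.1.2 by exact: corner.
pose ka i j c := kap (i, j, c).
have kaE i j c : E i i * c * E j j = ka i j c *: E i j := kapE (i, j, c).
have ka_uniq i j a b : a *: E i j = b *: E i j -> a = b.
  move=> /eqP; rewrite -subr_eq0 -scalerBl scaler_eq0 (negPf (E_neq0 i j)) orbF.
  by rewrite subr_eq0 => /eqP.
pose i0 := Ordinal (ltnW n_gt1); pose t := tau i0 (o i0).
have tE i j a : i != j -> tau i j a = t a.
  move=> ij; have [ii0|ii0] := eqVneq i0 i.
    by subst i; rewrite /t (n_eq2 ij (oE i0)).
  have oi : o i0 = i by apply: n_eq2 (oE i0) ii0.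
  have ji0 : j = i0 by apply: n_eq2 ij _; rewrite eq_sym.
  by rewrite /t oi ji0 tau_sym.
have tD a b : t (a + b) = t a + t b by apply: tauD (oE i0).
have tM a b : t (a * b) = t a * t b by apply: tauM (oE i0).
(* The images of the matrix units; the diagonal ones are products through the other index [o i], and
   [phi_sandwich] yields the matrix unit relations. *)
pose X i j := if i == j then phi (E i (o i)) * phi (E (o i) i) else phi (E i j).
have XM i j k l : X i j * X k l = if j == k then X i l else 0.
  have oo k' : o (o k') = k' by apply: n_eq2 (oE (o k')) _; rewrite eq_sym.
  have ok k' : o k' != k' by rewrite eq_sym.
  have pp := phi_square_zero (EE (oE i)); have qq := phi_square_zero (EE (ok i)).
  have pqp := phi_sandwich (oE i); have qpq := phi_sandwich (ok i).
  have cases k' : k' = i \/ k' = o i.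
    by have [->|ki] := eqVneq k' i; [left|right; apply: n_eq2 (oE i); rewrite eq_sym].
  have io_f : (i == o i) = false by apply/negbTE.
  have oi_f : (o i == i) = false by apply/negbTE.
  case: (cases j) (cases k) (cases l) => -> [] -> [] ->;
  rewrite /X ?eqxx ?io_f ?oi_f ?oo ?eqxx ?io_f ?oi_f ?mulrA;
  by rewrite ?pqp ?qpq ?(mulr_pre2 pp) ?(mulr_pre2 qq) ?pp ?qq ?mulr0 ?mul0r.
apply: (@automorphism_extension (fun i j c => t (ka i j c) *: X i j)).
- move=> i j a b; rewrite -scalerDl -tD; congr (t _ *: _); apply: (ka_uniq i j).
  by rewrite -kaE mulrDr mulrDl !kaE scalerDl.
- move=> i j a; congr (t _ *: _); apply: (ka_uniq i j).
  by rewrite -!kaE blockE.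
- move=> i j k a b; rewrite -scalerAl -scalerAr XM eqxx scalerA -tM.
  congr (t _ *: _); apply: (ka_uniq i k); rewrite -kaE.
  transitivity ((E i i * a * E j j) * (E j j * b * E k k)).
    by rewrite !kaE -scalerAl -scalerAr E_mul eqxx scalerA.
  by rewrite !mulrA -[_ * E j j * E j j]mulrA E_mul eqxx.
- by move=> i j k l a b jk; rewrite -scalerAl -scalerAr XM (negPf jk) !scaler0.
- move=> i j x ij bx; rewrite /X (negPf ij) -(tE i j) // -tauE // -kaE.
  by rewrite bx.
Qed.

End ScalarMap.

Lemma extension_rank2 : extends_to_ring_automorphism io f.
Proof. by have [tau tauE] := scalar_map; apply: extension_of_scalar_map tauE. Qed.

End Rank2.

End Frame.

End Automorphism.
End UnipotentGroup.

(** * The algebra of periodic matrices *)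

Section Embedding.
Variables (F : fieldType) (s : steinitz).
Local Notation A := (spmatrix F s).

Section OneSize.
Variables (n : nat) (sn : pos_divisors s n.+1).

Lemma Msp_diag (a : 'M[F]_n.+1) : Msp s (nmx_diag a).
Proof. by exists n.+1 => //; apply: Mnp_diag. Qed.

Definition emb (a : 'M[F]_n.+1) : A := SPMatrix (mem_set (Msp_diag a)).

Lemma embD a b : emb (a + b) = emb a + emb b.
Proof. by apply/val_inj/nmx_diagD. Qed.

Lemma embM a b : emb (a * b) = emb a * emb b.
Proof. by apply/val_inj; rewrite /= nmx_diagM. Qed.

Lemma emb1 : emb 1 = 1.
Proof. by apply/val_inj/nmx_diag1. Qed.

Lemma embZ c a : emb (c *: a) = c *: emb a.
Proof. by apply/val_inj; rewrite /= nmx_mapZ_diag. Qed.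

Lemma emb0 : emb 0 = 0.
Proof. by apply: (@addrI _ (emb 0)); rewrite -embD !addr0. Qed.

Lemma embN a : emb (- a) = - emb a.
Proof. by apply: (@addrI _ (emb a)); rewrite -embD !subrr emb0. Qed.

Lemma embX a k : emb (a ^+ k) = emb a ^+ k.
Proof. by elim: k => [|k IHk]; rewrite ?expr0 ?emb1 // !exprS embM IHk. Qed.

Lemma emb_inj : injective emb.
Proof.
move=> a b /(congr1 val) /= e; apply/matrixP => i j.
have := congr1 (fun A0 : nmatrix F => A0 i j) e.
by rewrite /nmx_diag !divn_small // eqxx !modn_small // !inord_val.
Qed.

Lemma emb_sum (I : Type) (r : seq I) (P : pred I) (c : I -> 'M_n.+1) :
  emb (\sum_(i <- r | P i) c i) = \sum_(i <- r | P i) emb (c i).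
Proof. by apply: big_morph; [exact: embD|exact: emb0]. Qed.

Lemma Mnp_emb (x : A) : Mnp n.+1 x -> exists a, x = emb a.
Proof. by move=> /MnpP[a xa]; exists a; apply: val_inj. Qed.

End OneSize.

(** Reduces statements about finitely many elements to one finite matrix algebra. Divisibility by
    [d] lets that algebra refine a given frame of size [d]. *)
Lemma common_size (d : nat) (xs : seq A) : pos_divisors s d -> exists n, exists
  sn : pos_divisors s n.+1, (d %| n.+1)%N /\ forall x, x \in xs -> exists a, x = emb sn a.
Proof.
move=> sd; suff [m [sm dm mxs]] : exists m, [/\ pos_divisors s m, (d %| m)%N &
    forall x : A, x \in xs -> Mnp m x].
  case: m sm dm mxs => [[]//|n] sm dm mxs.
  by exists n, sm; split=> // x /mxs; apply: Mnp_emb.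
elim: xs => [|x xs [m [sm dm mxs]]]; first by exists d.
have [k sk kx] := spmxP x; have [l0 sl] := pos_divisors_lcm sm sk.
exists (lcmn m k); split=> //; first by rewrite (dvdn_trans dm) ?dvdn_lcml.
move=> y; rewrite inE => /predU1P[->|/mxs yM].
  exact: Mnp_dvd l0 (dvdn_lcmr m k) kx.
exact: Mnp_dvd l0 (dvdn_lcml m k) yM.
Qed.

Lemma spmatrix_regular (x : A) : exists w, x * w * x = x.
Proof.
have [n [sn [_ H]]] := common_size [:: x] (pos_divisors1 s).
have [|a ->] := H x; first by rewrite inE.
have [w awa] := mx_regular a; exists (emb sn w).
by rewrite -!embM awa.
Qed.

Lemma spmatrix_prime (a b : A) : (forall x, a * x * b = 0) -> a = 0 \/ b = 0.
Proof.
have [n [sn [_ H]]] := common_size [:: a; b] (pos_divisors1 s).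
have [|a' ->] := H a; first by rewrite inE eqxx.
have [|b' ->] := H b; first by rewrite !inE eqxx orbT.
move=> ab; have [x|->|->] := @mx_prime F n a' b'; rewrite ?emb0; auto.
by apply: (@emb_inj _ sn); rewrite !embM ab emb0.
Qed.

Lemma spmatrix_bicommutant (x h : A) : x * x = 0 -> x != 0 ->
  (forall y, y * y = 0 -> x * y = y * x -> h * y = y * h) ->
  exists c d : F, h = c *: 1 + d *: x.
Proof.
have [n [sn [_ H]]] := common_size [:: x; h] (pos_divisors1 s).
have [|x' ->] := H x; first by rewrite inE eqxx.
have [|h' ->] := H h; first by rewrite !inE eqxx orbT.
rewrite -embM -(emb0 sn) (inj_eq (@emb_inj _ sn)) => /emb_inj xx x0 hC.
have [y yy xy|c [d ->]] := mx_bicommutant (h := h') xx x0.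
  by apply: (@emb_inj _ sn); rewrite !embM hC // -!embM ?yy ?xy.
by exists c, d; rewrite embD !embZ emb1.
Qed.

Lemma spmatrix_center (z : A) : (forall x, z * x = x * z) -> exists c : F, z = c *: 1.
Proof.
have [n [sn [_ H]]] := common_size [:: z] (pos_divisors1 s).
have [|z' ->] := H z; first by rewrite inE.
move=> zC; have [x|//|c ->] := @mx_martindale F n z' 1.
- by apply: (@emb_inj _ sn); rewrite mulr1 mul1r !embM zC.
- exact: oner_neq0.
by exists c; rewrite embZ emb1.
Qed.

Lemma spmatrix_power_unipotent (g g' h h' : A) :
  g * g' = 1 -> h * h' = 1 -> h * g = g ^+ 4 * h ->
  exists N k, (0 < N)%N /\ (g ^+ N - 1) ^+ k = 0.
Proof.
have [n [sn [_ H]]] := common_size [:: g; g'; h; h'] (pos_divisors1 s).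
have [|a ->] := H g; first by rewrite inE eqxx.
have [|a' ->] := H g'; first by rewrite !inE eqxx orbT.
have [|b ->] := H h; first by rewrite !inE eqxx !orbT.
have [|b' ->] := H h'; first by rewrite !inE eqxx !orbT.
rewrite -(emb1 sn) -embX -!embM => /emb_inj aa' /emb_inj bb' /emb_inj ba.
have [bU _] := mulmx1_unit bb'; have [aU _] := mulmx1_unit aa'.
have [N [k [N0 Nk]]] := mx_power_unipotent bU aU ba.
by exists N, k; split=> //; rewrite -embX -embN -embD -embX Nk emb0.
Qed.

Lemma unit_spGL (x y : A) : x * y = 1 -> y * x = 1 ->
  exists g : spGL F s, spmx_of_GL g = x.
Proof.
move=> xy yx; have [n [sn [_ H]]] := common_size [:: x; y] (pos_divisors1 s).
have [|a xE] := H x; first by rewrite inE eqxx.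
have [|b yE] := H y; first by rewrite !inE eqxx orbT.
have gx : GLsp s (spmx_val x).
  exists n.+1 => //; split; first by rewrite xE; apply: Mnp_diag.
  exists (spmx_val y); split; first by rewrite yE; apply: Mnp_diag.
    exact: (congr1 val xy).
  exact: (congr1 val yx).
by exists (SPGL (mem_set gx)); apply: val_inj.
Qed.

End Embedding.

(** * The special linear group inside the algebra *)

Section SpecialLinear.
Variables (F : fieldType) (s : steinitz).
Local Notation A := (spmatrix F s).
Local Notation GL := (spGL F s).
Local Notation SL := (spSL F s).

Definition ioGL (g : GL) : A := spmx_of_GL g.
Definition ioSL (g : SL) : A := ioGL (spSL_val g).

Lemma ioGL_inj : injective ioGL.
Proof. by move=> g h /(congr1 val) /= e; apply: val_inj. Qed.

Lemma ioGLM (g h : GL) : ioGL (g * h)%g = ioGL g * ioGL h.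
Proof. exact: val_inj. Qed.

Lemma ioGL1 : ioGL 1%g = 1.
Proof. exact: val_inj. Qed.

Lemma ioGLV (g : GL) : ioGL g * ioGL (g^-1)%g = 1.
Proof. by rewrite -ioGLM mulgV ioGL1. Qed.

Lemma ioSL_inj : injective ioSL.
Proof. by move=> g h /ioGL_inj; apply: val_inj. Qed.

Lemma ioSLM (g h : SL) : ioSL (g * h)%g = ioSL g * ioSL h.
Proof. exact: val_inj. Qed.

Lemma ioSL1 : ioSL 1%g = 1.
Proof. exact: val_inj. Qed.

Lemma commutator_SL (g h : GL) : exists k : SL, spSL_val k = [~ g, h]%g.
Proof.
have gh : [~ g, h]%g \in commutator_subgroup GL.
  by apply: mem_set; apply: sub_gen_smallest; exists g, h.
by exists (SPSL gh).
Qed.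

(* If [e] is an idempotent with [e x = x] and [x e = 0], conjugation by
   [t = 1 + e] maps [1 + x] to [1 + 2 x], so [1 + x] is a commutator. *)
Lemma unipotent_SL (x : A) : 2%N \notin [pchar F] -> x * x = 0 ->
  exists g : SL, ioSL g = 1 + x.
Proof.
rewrite inE /= => nz2 xx; have [w xwx] := spmatrix_regular x.
pose e := x * w; have ee : e * e = e by rewrite /e mulrA xwx.
pose t := 1 + e; pose t' := 1 - 2%:R^-1 *: e.
have half : 2%:R^-1 + 2%:R^-1 = 1 :> F by rewrite -mulr2n -[LHS]mulr_natr mulVf.
have he : 2%:R^-1 *: e + 2%:R^-1 *: e = e by rewrite -scalerDl half scale1r.
have tt' : t * t' = 1.
  rewrite mulrDl mul1r mulrBr mulr1 -scalerAr ee addrACA -opprD.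
  by rewrite he addrK.
have t't : t' * t = 1.
  rewrite mulrDr mulr1 mulrBl mul1r -scalerAl ee addrACA -opprD.
  by rewrite he addrK.
have [T ioT] := unit_spGL tt' t't.
have uu' : (1 + x) * (1 - x) = 1.
  by rewrite mulrDl mul1r mulrBr mulr1 xx subr0 subrK.
have u'u : (1 - x) * (1 + x) = 1.
  by rewrite mulrDr mulr1 mulrBl mul1r xx subr0 subrK.
have [V ioV] := unit_spGL uu' u'u.
have [k kE] := commutator_SL T^-1%g V^-1%g; exists k.
rewrite /ioSL kE /commg /conjg !invgK mulgA.
have TV : ioGL (T * V)%g = (1 + x) * ioGL (V * T)%g.
  have ex : e * x = x by [].
  have xe : x * e = 0 by rewrite /e mulrA xx mul0r.
  have uu : (1 + x) * (1 + x) = 1 + x + x by rewrite mulrDl mul1r mulrDr mulr1 xx addr0.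
  rewrite !ioGLM /ioGL ioT ioV mulrA uu /t.
  have -> : (1 + x + x) * (1 + e) = 1 + x + x + e.
    by rewrite mulrDr mulr1 !mulrDl mul1r xe !addr0.
  by rewrite mulrDl mul1r mulrDr mulr1 ex [e + x]addrC !addrA.
rewrite ioGLM TV -mulrA -ioGLM.
by rewrite mulgA mulgK mulgV ioGL1 mulr1.
Qed.

(* Ring endomorphisms of [A] map units to units, hence commutators of units to
   commutators of units. *)
Lemma multiplicative_restricts (Phi : A -> A) : Phi 1 = 1 ->
  {morph Phi : a b / a * b} -> exists f : SL -> SL, restricts_to Phi f.
Proof.
move=> Phi1 PhiM.
have /choice[fG fGE] (g : GL) : exists h : GL, ioGL h = Phi (ioGL g).
  apply: (unit_spGL (y := Phi (ioGL g^-1%g))); rewrite -PhiM -ioGLM.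
    by rewrite mulgV ioGL1.
  by rewrite mulVg ioGL1.
have fGM : {morph fG : x y / (x * y)%g}.
  by move=> x y; apply: ioGL_inj; rewrite ioGLM !fGE ioGLM PhiM.
exists (fun g => SPSL (commutator_subgroup_morph fGM (valP g))) => g.
exact: fGE.
Qed.

Lemma restricts_to_morph (Phi : A -> A) (f : SL -> SL) :
  {morph Phi : a b / a * b} -> restricts_to Phi f -> {morph f : x y / (x * y)%g}.
Proof.
move=> PhiM fPhi x y; have fE g : ioSL (f g) = Phi (ioSL g) := fPhi g.
by apply: ioSL_inj; rewrite ioSLM !fE ioSLM PhiM.
Qed.

Lemma restricts_to_AutSL (Phi : A -> A) (f : SL -> SL) : Phi 1 = 1 ->
  {morph Phi : a b / a * b} -> bijective Phi -> restricts_to Phi f -> AutSL F s f.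
Proof.
move=> Phi1 PhiM [Psi PhiK PsiK] fPhi; split; last exact: restricts_to_morph fPhi.
have Psi1 : Psi 1 = 1 by rewrite -Phi1 PhiK.
have PsiM : {morph Psi : a b / a * b}.
  by move=> a b; apply: (can_inj PhiK); rewrite PhiM !PsiK.
have [f' f'Psi] := multiplicative_restricts Psi1 PsiM.
exists f' => g; apply: ioSL_inj; rewrite /ioSL /ioGL.
  by rewrite f'Psi fPhi PhiK.
by rewrite fPhi f'Psi PsiK.
Qed.

(** * Generation by the block transvections of a frame *)

Section Frame.
Variables (d : nat) (sd : pos_divisors s d.+2).

Definition unit_matrix (i j : 'I_d.+2) : A := emb sd (delta_mx i j).

Variables (U : A -> SL).
Hypothesis ioU : forall x, x * x = 0 -> ioSL (U x) = 1 + x.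

Lemma unit_matrixM i j k l : unit_matrix i j * unit_matrix k l =
  if j == k then unit_matrix i l else 0.
Proof.
rewrite /unit_matrix -embM -mulmxE mul_delta_mx_cond.
by case: (j == k); rewrite ?mulr1n ?mulr0n ?emb0.
Qed.

Lemma unit_matrix_sum : \sum_i unit_matrix i i = 1.
Proof.
rewrite -(emb1 F sd) -emb_sum; congr emb; apply/matrixP => i j.
rewrite summxE (bigD1 i) //= big1 => [|k ki]; last by rewrite mxE [i == k]eq_sym (negPf ki).
by rewrite !mxE eqxx addr0 eq_sym.
Qed.

Lemma unit_matrix_neq0 i j : unit_matrix i j != 0.
Proof.
apply: contraTneq isT; rewrite -(emb0 F sd) => /emb_inj/matrixP/(_ i j)/eqP.
by rewrite !mxE !eqxx oner_eq0.
Qed.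

Section Multiple.
Variables (m : nat) (sm : pos_divisors s m.+1).
Hypothesis dm : (d.+2 %| m.+1)%N.

Definition residue (i : 'I_m.+1) : 'I_d.+2 := inord (i %% d.+2).

Lemma unit_matrix_diag k :
  unit_matrix k k = emb sm (\matrix_(i, j) ((i == j) && (residue i == k))%:R).
Proof.
apply/val_inj/funext => i; apply/funext => j; rewrite /= /nmx_diag !mxE.
(* Equality of indices is tested by quotient and remainder modulo both sizes, [d.+2] and its
   multiple [m.+1]. *)
have divmod p x y : (x == y) = (x %/ p == y %/ p)%N && (x %% p == y %% p)%N.
  apply/eqP/andP => [->//|[/eqP q /eqP r]].
  by rewrite (divn_eq x p) (divn_eq y p) q r.
have iM (x : nat) : (inord (x %% m.+1)%N : 'I_m.+1) = (x %% m.+1)%N :> nat.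
  by rewrite inordK ?ltn_pmod.
have rM (x : nat) : residue (inord (x %% m.+1)%N) = inord (x %% d.+2)%N.
  by rewrite /residue iM modn_dvdm.
rewrite rM -[inord _ == inord (j %% m.+1)%N]val_eqE /= !iM.
transitivity (((i == j) && (inord (i %% d.+2)%N == k))%:R : F).
  rewrite (divmod d.+2 i j); case: eqP => //= _; congr ((nat_of_bool _)%:R).
  case: eqP => [ik|_]; last by rewrite andbF.
  rewrite -ik -val_eqE /= !inordK ?ltn_pmod //.
  by rewrite andbT eq_sym.
by rewrite (divmod m.+1 i j); case: eqP.
Qed.

Lemma emb_delta_block i j (c : F) :
  peirce_block unit_matrix (residue i) (residue j) (emb sm (c *: delta_mx i j)).
Proof.
rewrite /peirce_block !unit_matrix_diag -!embM -!mulmxE; congr emb.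
have diagE k : \matrix_(i', j') ((i' == j') && (residue i' == k))%:R =
    diag_mx (\row_i' (residue i' == k)%:R) :> 'M[F]_m.+1.
  by apply/matrixP => p q; rewrite !mxE; case: eqP; rewrite ?mulr1n ?mulr0n.
rewrite !diagE mul_mx_diag mul_diag_mx; apply/matrixP => p q; rewrite !mxE.
case: (eqVneq p i) => [->|_]; case: (eqVneq q j) => [->|_];
by rewrite ?eqxx ?mulr1 ?mul1r ?mulr0 ?mul0r.
Qed.

End Multiple.

(** A commutator of units is elementary in some larger matrix algebra. A transvection there whose
    indices have distinct residues lies in an off-diagonal frame block; the others are commutators
    of two such. *)
Lemma transvections_generate (P : SL -> Prop) : P 1%g ->
  (forall g h, P g -> P h -> P (g * h)%g) ->
  (forall i j x, i != j -> peirce_block unit_matrix i j x -> P (U x)) -> forall g, P g.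
Proof.
(* [Q] makes [P] stable under inverses, which commutators require. *)
move=> P1 PM PU; pose Q g := P g /\ P g^-1%g.
have QM g h : Q g -> Q h -> Q (g * h)%g.
  by move=> [Pg Pg'] [Ph Ph']; split; rewrite ?invgM; apply: PM.
have QV g : Q g -> Q g^-1%g by move=> [Pg Pg']; split; rewrite ?invgK.
have Q1 : Q 1%g by split; rewrite ?invg1.
have QU i j x : i != j -> peirce_block unit_matrix i j x -> Q (U x).
  move=> ij bx; have xx : x * x = 0.
    rewrite -{}bx -!mulrA (mulrA (unit_matrix j j)) unit_matrixM.
    by rewrite eq_sym (negPf ij) mul0r !mulr0.
  split; first exact: PU bx.
  have -> : ((U x)^-1)%g = U (- x).
    apply: (@mulgI _ (U x)); rewrite mulgV; apply: ioSL_inj.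
    rewrite ioSLM ioSL1 !ioU // ?mulrNN // mulrDl mul1r mulrDr mulr1 mulrN xx.
    by rewrite oppr0 addr0 addrNK.
  by apply: PU ij _; rewrite /peirce_block mulrN mulNr bx.
suff QG g : Q g by move=> g; case: (QG g).
have elQ m (sm : pos_divisors s m.+1) (dm : (d.+2 %| m.+1)%N) (t : 'M[F]_m.+1) :
    elementary t -> exists2 h, Q h & ioSL h = emb sm t.
  elim=> {t} [|i j c ij|a b _ [h Qh ha] _ [k Qk kb]].
  - by exists 1%g; rewrite // ioSL1 -(emb1 F sm).
  - have sq (p q : 'I_m.+1) (e : F) : p != q ->
        emb sm (e *: delta_mx p q) * emb sm (e *: delta_mx p q) = 0.
      move=> pq; rewrite -embM -mulmxE -scalemxAl -scalemxAr mul_delta_mx_0 ?scaler0 ?emb0 //.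
      by rewrite eq_sym.
    have ioT (p q : 'I_m.+1) (e : F) : p != q ->
        ioSL (U (emb sm (e *: delta_mx p q))) = emb sm (transvection p q e).
      by move=> pq; rewrite ioU ?sq // /transvection embD (emb1 F sm).
    have [rij|rij] := eqVneq (residue i) (residue j); last first.
      by exists (U (emb sm (c *: delta_mx i j))); [apply: QU rij _; apply: emb_delta_block | apply: ioT].
    (* The intermediate index is 0 or 1, whichever has a residue other than that of [i]. *)
    have [k rk] : exists k : 'I_m.+1, residue k != residue i.
      have [r0|r0] := eqVneq (residue i) ord0; last first.
        by exists ord0; apply: contra_neq r0 => <-; apply/val_inj; rewrite /= inordK mod0n.
      have m1 : (1 < m.+1)%N by apply: leq_trans (dvdn_leq _ dm).
      exists (Ordinal m1); rewrite r0 -val_eqE /= inordK ?ltn_pmod // modn_small //.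
    have ik : i != k by apply: contra_neq rk => ->.
    have kj : k != j by apply: contra_neq rk => ->; rewrite rij.
    pose x := emb sm (c *: delta_mx i k); pose y := emb sm ((1 : F) *: delta_mx k j).
    exists (U x * U y * (U y * U x)^-1)%g.
      have rik : residue i != residue k by rewrite eq_sym.
      have Qx : Q (U x) by apply: QU rik _; apply: emb_delta_block.
      have rkj : residue k != residue j by rewrite -rij.
      have Qy : Q (U y) by apply: QU rkj _; apply: emb_delta_block.
      by apply: QM (QM _ _ _ _) (QV _ (QM _ _ _ _)).
    pose z := emb sm (c *: delta_mx i j).
    have xy : x * y = z.
      by rewrite -embM -mulmxE -scalemxAl -scalemxAr mul_delta_mx scale1r.
    have yx : y * x = 0.
      rewrite -embM -mulmxE -scalemxAl -scalemxAr mul_delta_mx_0 ?scaler0 ?emb0 //.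
      by rewrite eq_sym.
    have zx : z * x = 0.
      rewrite -embM -mulmxE -scalemxAl -scalemxAr mul_delta_mx_0 ?scaler0 ?emb0 //.
      by rewrite eq_sym.
    have zy : z * y = 0.
      rewrite -embM -mulmxE -scalemxAl -scalemxAr mul_delta_mx_0 ?scaler0 ?emb0 //.
      by rewrite eq_sym.
    (* As [y x = 0], [(1 + x)(1 + y) = (1 + xy)(1 + y)(1 + x)], so [1 + z] is the commutator. *)
    have ioz : ioSL (U x * U y)%g = (1 + z) * ioSL (U y * U x)%g.
      rewrite !ioSLM !ioU ?sq //.
      have -> : (1 + y) * (1 + x) = 1 + x + y by rewrite mulrDl mul1r mulrDr mulr1 yx addr0.
      have zE : z * (1 + x + y) = z by rewrite !mulrDr mulr1 zx zy !addr0.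
      by rewrite [LHS]mulrDr mulr1 mulrDl mul1r xy [RHS]mulrDl mul1r zE !addrA.
    rewrite ioSLM ioz -mulrA -ioSLM mulgV ioSL1 mulr1.
    by rewrite /transvection embD (emb1 F sm).
  - by exists (h * k)%g; [apply: QM | rewrite ioSLM ha kb -embM].
pose S : set GL := [set h | exists2 k : SL, Q k & spSL_val k = h].
have : S (spSL_val g).
  have := valP g; rewrite inE => gC; apply: gC; split.
    split; first by apply: mem_set; exists 1%g.
    move=> _ _ /set_mem[h Qh <-] /set_mem[k Qk <-]; apply: mem_set.
    by exists (h * k^-1)%g => //; apply: QM Qh (QV _ Qk).
  move=> _ [a [b ->]].
  have [m [sm [dm H]]] := common_size [:: ioGL a; ioGL a^-1%g; ioGL b; ioGL b^-1%g] sd.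
  have [|a1 a1E] := H (ioGL a); first by rewrite inE eqxx.
  have [|a2 a2E] := H (ioGL a^-1%g); first by rewrite !inE eqxx orbT.
  have [|b1 b1E] := H (ioGL b); first by rewrite !inE eqxx !orbT.
  have [|b2 b2E] := H (ioGL b^-1%g); first by rewrite !inE eqxx !orbT.
  have invE p p' (q : GL) : ioGL q = emb sm p -> ioGL q^-1%g = emb sm p' -> p *m p' = 1%:M.
    move=> qp qp'; apply: (@emb_inj _ _ _ sm); rewrite [LHS]embM -qp -qp' ioGLV.
    by rewrite -(emb1 F sm).
  have a2U : a2 \in unitmx by case: (mulmx1_unit (invE _ _ _ a1E a2E)).
  have b2U : b2 \in unitmx by case: (mulmx1_unit (invE _ _ _ b1E b2E)).
  have [t /(elQ m sm dm)[h Qh ht] abt] := unitmx_comm_mod_elementary a2U b2U.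
  exists h => //; apply: ioGL_inj; rewrite -[LHS]/(ioSL h) ht.
  have e : ioGL (a^-1 * b^-1)%g = emb sm t * ioGL (b^-1 * a^-1)%g.
    by rewrite !ioGLM a2E b2E -!embM; congr emb.
  rewrite /commg /conjg mulgA ioGLM e -mulrA -ioGLM -invgM mulVg.
  by rewrite ioGL1 mulr1.
by case=> k Qk /val_inj <-.
Qed.

End Frame.
End SpecialLinear.

(** * Automorphisms of the special linear group *)

Section Automorphisms.
Variables (F : fieldType) (s : steinitz).
Local Notation A := (spmatrix F s).
Local Notation GL := (spGL F s).
Local Notation SL := (spSL F s).
Local Notation io := (@ioSL F s).

Lemma Msp_tr (B : nmatrix F) : Msp s B -> Msp s (nmx_tr B).
Proof. by move=> [n sn nB]; exists n => //; apply: Mnp_tr. Qed.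

Definition spmx_tr (x : A) : A := SPMatrix (mem_set (Msp_tr (spmxP x))).

Lemma spmx_trB x y : spmx_tr (x - y) = spmx_tr x - spmx_tr y.
Proof. exact: val_inj. Qed.

Lemma spmx_tr1 : spmx_tr 1 = 1.
Proof. by apply/val_inj/nmx_tr1. Qed.

Lemma spmx_trM x y : spmx_tr (x * y) = spmx_tr y * spmx_tr x.
Proof. by apply/val_inj/nmx_trM. Qed.

Lemma io_psi (g : SL) : io (psi g) = spmx_tr (io g^-1%g).
Proof. exact: val_inj. Qed.

Lemma psiM : {morph @psi F s : x y / (x * y)%g}.
Proof.
move=> x y; apply: ioSL_inj.
by rewrite ioSLM !io_psi invgM ioSLM spmx_trM.
Qed.

Lemma spSL_unipotent_embedding : 2%N \notin [pchar F] ->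
  exists U : A -> SL, unipotent_embedding io U.
Proof.
move=> char2.
have /choice[U UE] (x : A) : exists g : SL, x * x = 0 -> io g = 1 + x.
  have [xx|xx] := pselect (x * x = 0); last by exists 1%g.
  by have [g gE] := unipotent_SL char2 xx; exists g.
exists U; split.
- exact: ioSL_inj.
- exact: ioSL1.
- exact: ioSLM.
- exact: UE.
- exact: spmatrix_regular.
- exact: spmatrix_prime.
- exact: spmatrix_bicommutant.
- move=> g h; apply: (spmatrix_power_unipotent (g' := io g^-1%g) (h' := io h^-1%g)).
    by rewrite -ioSLM mulgV ioSL1.
  by rewrite -ioSLM mulgV ioSL1.
Qed.

Lemma unit_matrix_frame (U : A -> SL) d (sd : pos_divisors s d.+2) :
  unipotent_embedding io U -> matrix_frame U (@unit_matrix F s d sd).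
Proof.
move=> ax; split=> //.
- exact: unit_matrixM.
- exact: unit_matrix_sum.
- exact: unit_matrix_neq0.
exact: transvections_generate (io_unipotent ax).
Qed.

(** All matrices involved are scalar, so units commute and commutators are trivial. *)
Lemma SL_size1 : (forall n, pos_divisors s n -> n = 1%N) -> forall g : SL, g = 1%g.
Proof.
move=> s1 g; apply: val_inj; have := valP g; rewrite inE => gC.
suff : [set (1%g : GL)] (spSL_val g) by [].
apply: gC; split.
  split; first by rewrite inE.
  by move=> _ _ /set_mem -> /set_mem ->; rewrite inE /= mulgV.
move=> _ [a [b ->]] /=.
suff ab : (a * b = b * a)%g by rewrite /commg /conjg ab mulKg mulVg.
have [n [sn [_ H]]] := common_size [:: ioGL a; ioGL b] (pos_divisors1 s).
have [|a' aE] := H (ioGL a); first by rewrite inE eqxx.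
have [|b' bE] := H (ioGL b); first by rewrite !inE eqxx orbT.
apply: ioGL_inj; rewrite !ioGLM aE bE -!embM; congr emb.
case: n sn a' b' {H aE bE} (s1 _ sn) => // sn a' b' _.
by rewrite [a']mx11_scalar -!mulmxE scalar_mxC.
Qed.

(** * From group automorphisms to ring automorphisms *)

Section Char.
Hypotheses (char2 : 2%N \notin [pchar F]) (char3 : 3%N \notin [pchar F]).

Lemma AutSL_extends (f : SL -> SL) : AutSL F s f ->
  extends_to_ring_automorphism io f \/ extends_to_ring_automorphism io (@psi F s \o f).
Proof.
move=> [[fi fK fiK] fM]; have [U ax] := spSL_unipotent_embedding char2.
(* Three cases: some divisor is at least 3, the largest divisor is 2, or 1 is the only divisor. *)
have [[d sd]|no3] := pselect (exists d, pos_divisors s d.+3).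
  have fr := unit_matrix_frame sd ax.
  have [nd|nn] := no_dual_or_no_natural_part char2 char3 ax fM fK fiK fr.
    left; exact: (extension_rank3 char2 char3 ax fM fK fiK fr isT nd).
  right; pose f' := @psi F s \o f; pose f'i := fi \o @psi F s.
  have f'M : {morph f' : x y / (x * y)%g} by move=> x y; rewrite /f' /= fM psiM.
  have f'K : cancel f' f'i by move=> x; rewrite /f' /f'i /= psiK fK.
  have f'iK : cancel f'i f' by move=> x; rewrite /f' /f'i /= fiK psiK.
  apply: (extension_rank3 char2 char3 ax f'M f'K f'iK fr) => //.
  (* Composition with [psi] replaces [phi x] by minus its transpose, which reverses products and so
     exchanges the natural and dual parts. *)
  have phi_f' x : x * x = 0 -> phi io U f' x = - spmx_tr (phi io U f x).
    move=> xx; apply: (@addrI _ 1); rewrite -phiE io_psi.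
    have XX := phi_square_zero char2 char3 ax fM fK fiK xx.
    have -> : io (f (U x))^-1%g = 1 - phi io U f x.
      have uu : (1 + phi io U f x) * (1 - phi io U f x) = 1.
        by rewrite mulrDl mul1r mulrBr mulr1 XX subr0 subrK.
      transitivity (io (f (U x))^-1%g * ((1 + phi io U f x) * (1 - phi io U f x))).
        by rewrite uu mulr1.
      by rewrite mulrA -phiE -ioSLM mulVg ioSL1 mul1r.
    by rewrite spmx_trB spmx_tr1.
  move=> i j k x y ij jk ik bx by_.
  have xx := block_square_zero fr ij bx; have yy := block_square_zero fr jk by_.
  rewrite !phi_f' // mulrNN -spmx_trM (nn _ _ _ _ _ ij jk ik bx by_).
  exact: val_inj.
have divisors n : pos_divisors s n -> (n <= 2)%N.
  by case: n => [|[|[|n]]] // sn; case: no3; exists n.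
left; have [s2|s2] := pselect (pos_divisors s 2).
  have fr := unit_matrix_frame s2 ax.
  apply: (extension_rank2 char2 char3 ax fM fK fiK fr).
    by move=> [[|[|i]] //= Hi] [[|[|j]] //= Hj] [[|[|k]] //= Hk] //= _ _; apply: val_inj.
  (* The common size is a multiple of 2 and at most 2, so [c] is a two by two matrix and its blocks
     are single entries. *)
  move=> i j c; have [n [sn [dn H]]] := common_size [:: c] s2.
  have [|a cE] := H c; first by rewrite inE.
  have n2 : n = 1%N.
    apply/eqP; rewrite -eqSS eqn_leq (divisors _ sn).
    exact: dvdn_leq.
  subst n; exists (a i j); have -> : c = emb s2 a by rewrite cE; apply: val_inj.
  rewrite /unit_matrix -!embM -embZ; congr emb.
  exact: delta_mx_sandwich.
have s1 n : pos_divisors s n -> n = 1%N.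
  by case: n => [[]//|[|[|n]]] // sn; have := divisors _ sn.
have f_id g : f g = g by rewrite [f g](SL_size1 s1) [g](SL_size1 s1).
by exists id; split=> // [|g]; [exists id | rewrite f_id].
Qed.

End Char.

(** * Field automorphisms and ring automorphisms *)

Lemma nmx_map_diag (tau : {rmorphism F -> F}) n (a : 'M[F]_n.+1) :
  nmx_map tau (nmx_diag a) = nmx_diag (map_mx tau a).
Proof.
apply/funext => i; apply/funext => j; rewrite /nmx_map /nmx_diag mxE.
by case: eqP; rewrite ?rmorph0.
Qed.

Lemma spmx_mapM (tau : {rmorphism F -> F}) : {morph @spmx_map F s tau : x y / x * y}.
Proof.
move=> x y; have [n [sn [_ H]]] := common_size [:: x; y] (pos_divisors1 s).
have [|a ->] := H x; first by rewrite inE eqxx.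
have [|b ->] := H y; first by rewrite !inE eqxx orbT.
apply: val_inj; rewrite -embM /= !nmx_map_diag nmx_diagM.
by rewrite [map_mx _ _]rmorphM.
Qed.

Lemma spmx_map1 (tau : {rmorphism F -> F}) : @spmx_map F s tau 1 = 1.
Proof.
apply/val_inj/funext => i; apply/funext => j.
by rewrite /= /nmx_map /nmx1; case: eqP; rewrite ?rmorph1 ?rmorph0.
Qed.

Lemma spmx_mapB (tau : {rmorphism F -> F}) x y :
  @spmx_map F s tau (x - y) = spmx_map tau x - spmx_map tau y.
Proof. by apply/val_inj/funext => i; apply/funext => j; apply: rmorphB. Qed.

Lemma spmx_mapZ (tau : {rmorphism F -> F}) c x :
  @spmx_map F s tau (c *: x) = tau c *: spmx_map tau x.
Proof. by apply/val_inj/funext => i; apply/funext => j; apply: rmorphM. Qed.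

Lemma spmx_mapK (tau tau' : {rmorphism F -> F}) : cancel tau tau' ->
  cancel (@spmx_map F s tau) (spmx_map tau').
Proof.
by move=> tauK x; apply/val_inj/funext => i; apply/funext => j; apply: tauK.
Qed.

Lemma spmx_map_bij (tau : {rmorphism F -> F}) : bijective tau -> bijective (@spmx_map F s tau).
Proof.
move=> [tau' tauK tau'K]; have tau'0 : tau' 0 = 0 by rewrite -{1}(rmorph0 tau) tauK.
exists (fun x => SPMatrix (mem_set (Msp_map tau'0 (spmxP x)))) => x; apply/val_inj/funext => i; apply/funext => j; rewrite /= /nmx_map.
  by rewrite tauK.
by rewrite tau'K.
Qed.

(** The center consists of the scalars and is preserved. The inverse [tau'] is also delivered as a
    morphism, because untwisting [Phi] applies it entrywise. *)
Lemma ring_automorphism_center (Phi : A -> A) :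
  {morph Phi : a b / a + b} -> {morph Phi : a b / a * b} -> Phi 1 = 1 -> bijective Phi ->
  exists tau tau' : {rmorphism F -> F}, [/\ cancel tau tau', cancel tau' tau &
    forall c, Phi (c *: 1) = tau c *: 1].
Proof.
move=> PhiD PhiM Phi1 [Psi PhiK PsiK].
have cC (c : F) (x : A) : c *: 1 * x = x * (c *: 1).
  by rewrite -scalerAl -scalerAr mul1r mulr1.
have /choice[tau tauE] c : exists d : F, Phi (c *: 1) = d *: 1.
  by apply: spmatrix_center => x; rewrite -[x]PsiK -!PhiM cC.
have /choice[tau' tau'E] c : exists d : F, Psi (c *: 1) = d *: 1.
  by apply: spmatrix_center => x; apply: (can_inj PhiK); rewrite !PhiM !PsiK cC.
have scal1_inj (c d : F) : c *: (1 : A) = d *: 1 -> c = d.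
  move/eqP; rewrite -subr_eq0 -scalerBl scaler_eq0 oner_eq0 orbF subr_eq0.
  by move/eqP.
have tauK : cancel tau tau'.
  by move=> c; apply: scal1_inj; rewrite -tau'E -tauE PhiK.
have tau'K : cancel tau' tau.
  by move=> c; apply: scal1_inj; rewrite -tauE -tau'E PsiK.
have Phi0 : Phi 0 = 0 by apply: (@addrI _ (Phi 0)); rewrite -PhiD !addr0.
have PhiN a : Phi (- a) = - Phi a.
  by apply: (@addrI _ (Phi a)); rewrite -PhiD !subrr.
have tauB : zmod_morphism tau.
  by move=> c d; apply: scal1_inj; rewrite -tauE !scalerBl PhiD PhiN !tauE.
have tauM : monoid_morphism tau.
  split=> [|c d]; apply: scal1_inj; first by rewrite -tauE !scale1r.
  by rewrite -tauE -scalerA -[d *: (1 : A)]mul1r scalerAl PhiM !tauE -scalerAl mul1r scalerA.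
have tau'B : zmod_morphism tau'.
  by move=> c d; apply: (can_inj tauK); rewrite tauB !tau'K.
have tau'M : monoid_morphism tau'.
  split=> [|c d]; apply: (can_inj tauK); first by rewrite tau'K (tauM.1).
  by rewrite (tauM.2) !tau'K.
pose tR : {rmorphism F -> F} := HB.pack tau
  (GRing.isZmodMorphism.Build _ _ tau tauB) (GRing.isMonoidMorphism.Build _ _ tau tauM).
pose tR' : {rmorphism F -> F} := HB.pack tau'
  (GRing.isZmodMorphism.Build _ _ tau' tau'B) (GRing.isMonoidMorphism.Build _ _ tau' tau'M).
by exists tR, tR'.
Qed.

(** Applying [tau'] entrywise before [Phi] cancels the action on scalars, leaving an [F]-algebra
    automorphism; the entrywise [tau] is the right-hand factor. *)
Lemma extends_to_ring_automorphism_factor (f : SL -> SL) :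
  extends_to_ring_automorphism io f -> comp_set (Aut_alg F s) (Aut_field F s) f.
Proof.
move=> [Phi [PhiD PhiM Phi1 Phi_bij fE]].
have [tau [tau' [tauK tau'K tauE]]] := ring_automorphism_center PhiD PhiM Phi1 Phi_bij.
pose Lam := Phi \o @spmx_map F s tau'.
have PhiZ c x : Phi (c *: x) = tau c *: Phi x.
  by rewrite -[x in LHS]mul1r scalerAl PhiM tauE -scalerAl mul1r.
have Phi0 : Phi 0 = 0 by apply: (@addrI _ (Phi 0)); rewrite -PhiD !addr0.
have PhiN a : Phi (- a) = - Phi a.
  by apply: (@addrI _ (Phi a)); rewrite -PhiD !subrr.
have LamB : zmod_morphism Lam.
  by move=> x y; rewrite /Lam /= spmx_mapB PhiD PhiN.
have LamM : monoid_morphism Lam.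
  by split=> [|x y]; rewrite /Lam /= ?spmx_map1 // spmx_mapM PhiM.
have LamZ : scalable Lam by move=> c x; rewrite /Lam /= spmx_mapZ PhiZ tau'K.
pose L : {lrmorphism A -> A} := HB.pack Lam
  (GRing.isZmodMorphism.Build _ _ Lam LamB) (GRing.isMonoidMorphism.Build _ _ Lam LamM)
  (GRing.isScalable.Build _ _ _ _ Lam LamZ).
have [f2 f2E] := multiplicative_restricts (spmx_map1 tau) (@spmx_mapM tau).
have [f2' f2'E] := multiplicative_restricts (spmx_map1 tau') (@spmx_mapM tau').
exists (f \o f2'), f2; split.
- exists L; split; last by move=> g; rewrite [LHS]fE; congr Phi; apply: f2'E.
  apply: bij_comp => //.
  by exists (spmx_map tau); apply: spmx_mapK.
- by exists tau; split=> //; exists tau'.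
apply/funext => g /=; congr f; apply: ioSL_inj.
by rewrite [RHS]f2'E f2E (spmx_mapK tauK).
Qed.

Lemma AutSL_comp (f g : SL -> SL) : AutSL F s f -> AutSL F s g -> AutSL F s (f \o g).
Proof.
move=> [fB fM] [gB gM]; split; first exact: bij_comp.
by move=> x y /=; rewrite gM fM.
Qed.

Lemma AutSL_iter_psi k : AutSL F s (iter k (@psi F s)).
Proof.
elim: k => [|k IHk]; first by split=> //; exists id.
by apply: (@AutSL_comp (@psi F s)) IHk; split; [exists (@psi F s); apply: psiK | apply: psiM].
Qed.

End Automorphisms.

Local Close Scope classical_set_scope.
Local Close Scope ring_scope.

Theorem theorem6 (F : fieldType) (s : steinitz)
    (char_neq2 : 2 \notin [pchar F]%R) (char_neq3 : 3 \notin [pchar F]%R) :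
  AutSL F s = comp_set (comp_set (psi_group F s) (Aut_alg F s)) (Aut_field F s).
Proof.
apply/seteqP; split=> f.
  case/(AutSL_extends char_neq2 char_neq3) => /extends_to_ring_automorphism_factor.
    move=> [f1 [f2 [algf1 fieldf2 ->]]]; exists f1, f2; split=> //.
    by exists id, f1; split=> //; exists 0%N.
  (* Here [psi \o f] factors as [f1 \o f2], and [psi] is an involution, so [f] is
     [psi \o f1 \o f2]. *)
  move=> [f1 [f2 [algf1 fieldf2 psif]]]; exists (@psi F s \o f1), f2; split=> //.
    by exists (@psi F s), f1; split=> //; exists 1%N.
  apply/funext => g; rewrite /= -[f1 (f2 g)]/((f1 \o f2) g) -psif /=.
  by rewrite psiK.
move=> [_ [f2 [[_ [f1 [[k ->] [Phi [Phi_bij f1E]] ->]]] [tau [tau_bij f2E]] ->]]].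
apply: AutSL_comp; first apply: AutSL_comp; first exact: AutSL_iter_psi.
  exact: restricts_to_AutSL (rmorph1 Phi) (rmorphM Phi) Phi_bij f1E.
apply: restricts_to_AutSL (spmx_map1 s tau) (@spmx_mapM F s tau) _ f2E.
exact: spmx_map_bij.
Qed.
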